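(* Let $G_1$ be a finite connected oriented graph with distinguished vertices $a_1,b_1$ such that $d_1(a_1,b_1)>1$ and there exist at least two edge-disjoint paths connecting $a_1$ to $b_1$ in $G_1$. Let $f=f_1$ and $f_k$ be the crossing probability functions of the hierarchical graphs with seed $G_1$, $p_\star$ the unique fixed point of $f$ in $(0,1)$, and $\zeta=f'(p_\star)>1$. Then for any $\lambda\in\mathbb R$, $$f_k\Big(p_\star+\frac{\lambda}{\zeta^k}\Big)\xrightarrow[k\to\infty]{}h^{-1}(\lambda),$$ where $h:(0,1)\to\mathbb R$ is the diffeomorphism characterized as the unique linear conjugation of $f$ (that is, $h\circ f=\zeta\cdot h$ on $(0,1)$) such that $h'(p_\star)=1$. Moreover, there exist constants $c_1,c_2>0$ such that $$\exp(-c_1|\lambda|^\nu)\le h^{-1}(\lambda)\le\exp(-c_1^{-1}|\lambda|^\nu)\qquad\text{as }\lambda\to-\infty$$ and $$1-\exp(-c_2\lambda^\mu)\le h^{-1}(\lambda)\le 1-\exp(-c_2^{-1}\lambda^\mu)\qquad\text{as }\lambda\to\infty,$$ where $\nu=\log_\zeta d_1(a_1,b_1)$ and $\mu=\log_\zeta\mathrm{Cut}(G_1)$.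
   Context: $G_1=(V_1,\mathcal E_1)$ is a finite connected oriented graph (a finite simple graph with an orientation chosen for each edge), with two distinguished vertices $a_1,b_1$. Orientations are used only to define the replacement operation below; distances, paths, cuts and connectivity ignore orientation. $d_1$ is the graph distance in $G_1$. $\mathrm{Cut}(G_1)$ is the minimum number of edges of $G_1$ whose removal disconnects $a_1$ from $b_1$. Hierarchical graphs: $G_0$ is a single oriented edge $(a_0,b_0)$. Given $G_k=(V_k,\mathcal E_k)$ with distinguished vertices $a_k,b_k$, $G_{k+1}$ is obtained by replacing each oriented edge $(x,y)\in\mathcal E_k$ by a fresh copy of $G_1$, with $a_1$ identified with $x$ and $b_1$ with $y$; $a_{k+1},b_{k+1}$ are the vertices that were $a_k,b_k$. Percolation: under $\mathbb P^k_p$ each edge of $G_k$ is independently open with probability $p$. $f_k(p)=\mathbb P^k_p(a_k\leftrightarrow b_k)$ is the probability that $a_k$ and $b_k$ are joined by an open path. Under the stated hypothesis on $G_1$, $f_1$ has exactly one fixed point $p_\star$ in $(0,1)$ and $f_1'(p_\star)>1$. ''As $\lambda\to\pm\infty$'' means: for all $\lambda$ with the indicated sign and $|\lambda|$ sufficiently large. In the first limit $k$ is taken large enough that $p_\star+\lambda/\zeta^k\in[0,1]$. *)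

(* Defs.v *)
From HB Require Import structures.
From mathcomp Require Import all_boot all_order all_algebra.
From mathcomp Require Import all_classical all_reals all_analysis.

Set Implicit Arguments.
Unset Strict Implicit.
Unset Printing Implicit Defensive.

Import Order.TTheory GRing.Theory Num.Theory.
Import numFieldNormedType.Exports.

Local Open Scope classical_set_scope.
Local Open Scope ring_scope.

(* An oriented graph with two distinguished vertices.  Edges form a type of
   their own, which makes edge replacement easy to write; that the graph is
   simple is the separate predicate [simple_graph]. *)
Record ograph := OGraph {
  vertex : finType;
  edge : finType;
  src : edge -> vertex;
  tgt : edge -> vertex;
  va : vertex;
  vb : vertex
}.

Section Graphs.
Variable G : ograph.

Definition joins (e : edge G) (x y : vertex G) : bool :=
  ((src e == x) && (tgt e == y)) || ((src e == y) && (tgt e == x)).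

Definition simple_graph : Prop :=
  (forall e : edge G, src e != tgt e) /\
  (forall (e e' : edge G) (x y : vertex G), joins e x y -> joins e' x y -> e = e').

Definition adj (S : {set edge G}) : rel (vertex G) :=
  fun x y => [exists e in S, joins e x y].

Definition linked (S : {set edge G}) (x y : vertex G) : bool :=
  connect (adj S) x y.

Definition connected_graph : Prop :=
  forall x y : vertex G, linked [set: edge G] x y.

(* A path out of [x] is recorded as the sequence of pairs
   (edge traversed, vertex reached). *)
Fixpoint walk (x : vertex G) (p : seq (edge G * vertex G)) : bool :=
  if p is (e, z) :: p' then joins e x z && walk z p' else true.

Definition path_edges (p : seq (edge G * vertex G)) : seq (edge G) :=
  [seq s.1 | s <- p].

Definition path_vertices (x : vertex G) (p : seq (edge G * vertex G)) :
    seq (vertex G) :=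
  x :: [seq s.2 | s <- p].

Definition is_path (x y : vertex G) (p : seq (edge G * vertex G)) : bool :=
  [&& walk x p, last x (path_vertices x p) == y & uniq (path_vertices x p)].

(* A path has fewer than #|vertex G| edges, so the bound on [n] is harmless;
   the default value #|vertex G| is only reached when no path exists. *)
Definition dist (x y : vertex G) : nat :=
  \big[minn/#|vertex G|]_(n < #|vertex G| |
      [exists p : n.-tuple (edge G * vertex G), is_path x y p]) (n : nat).

Definition two_edge_disjoint_paths (x y : vertex G) : Prop :=
  exists p q : seq (edge G * vertex G),
    [/\ is_path x y p, is_path x y q, p <> q &
        forall e : edge G, ~ (e \in path_edges p /\ e \in path_edges q)].

(* If [va G != vb G] then removing every edge disconnects them, so the
   default value #|edge G| is itself attained by an admissible set. *)
Definition Cut : nat :=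
  \big[minn/#|edge G|]_(S : {set edge G} | ~~ linked (~: S) (va G) (vb G)) #|S|.

Variable R : realType.

(* [S] is the set of open edges. *)
Definition perc_prob (p : R) (A : pred {set edge G}) : R :=
  \sum_(S : {set edge G} | A S) \prod_(e : edge G) (if e \in S then p else 1 - p).

Definition crossing_prob (p : R) : R :=
  perc_prob p (fun S => linked S (va G) (vb G)).

End Graphs.

Definition single_edge : ograph :=
  @OGraph bool unit (fun=> false) (fun=> true) false true.

Section Replacement.
Variables G H : ograph.

Definition inner : finType := {v : vertex H | (v != va H) && (v != vb H)}.

Definition repl_vertex : finType := (vertex G + edge G * inner)%type.

(* The vertex [v] of the copy of [H] put in place of the edge [e] of [G]. *)
Definition repl_emb (e : edge G) (v : vertex H) : repl_vertex :=
  match @insub _ (fun v => (v != va H) && (v != vb H)) inner v with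
  | Some w => inr (e, w)
  | None => inl (if v == va H then src e else tgt e)
  end.

Definition replace_edges : ograph :=
  @OGraph repl_vertex (edge G * edge H)%type
    (fun ee => repl_emb ee.1 (src ee.2)) (fun ee => repl_emb ee.1 (tgt ee.2))
    (inl (va G)) (inl (vb G)).

End Replacement.

Fixpoint hgraph (G1 : ograph) (k : nat) : ograph :=
  if k is k'.+1 then replace_edges (hgraph G1 k') G1 else single_edge.

Section Conjugation.
Variable R : realType.

Definition unit_itv : set R := [set x | 0 < x < 1].

(* Meaningful for open [U]: iterated derivatives are then local to [U],
   whatever the values of [g] outside. *)
Definition class_C (r : nat) (U : set R) (g : R -> R) : Prop :=
  (forall i : nat, (i < r)%N -> forall x, U x -> derivable (g^`(i))%classic x 1) /\
  (forall x, U x -> {for x, continuous (g^`(r))%classic}).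

(* [g] restricted to [U] is a C^r diffeomorphism onto [V] with inverse [ginv]. *)
Definition diffeo (r : nat) (U V : set R) (g ginv : R -> R) : Prop :=
  [/\ forall x, U x -> V (g x) /\ ginv (g x) = x,
      forall y, V y -> U (ginv y) /\ g (ginv y) = y,
      class_C r U g & class_C r V ginv].

Definition linear_conjugation (r : nat) (f : R -> R) (zeta pstar : R)
    (h hinv : R -> R) : Prop :=
  [/\ diffeo r unit_itv setT h hinv,
      forall x, unit_itv x -> h (f x) = zeta * h x &
    (h^`())%classic pstar = 1].

Definition log_base (b x : R) : R := ln x / ln b.

End Conjugation.

(* Main.v *)
Require Import Defs.
From HB Require Import structures.
From mathcomp Require Import all_boot all_order all_algebra.
From mathcomp Require Import all_classical all_reals all_analysis.
From mathcomp Require Import ring lra.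
Import Order.TTheory GRing.Theory Num.Theory.
Import numFieldNormedType.Exports.
Local Open Scope classical_set_scope.
Local Open Scope ring_scope.

Set Implicit Arguments.
Unset Strict Implicit.
Unset Printing Implicit Defensive.

(** Replacing every edge by a copy of the seed composes crossing probabilities
([crossing_prob_replace]): a copy behaves like a single edge that is open with
probability f(p), independently of the other copies. Hence f_k is the k-th
iterate of the polynomial f, and the theorem is a statement about the dynamics
of f on the unit interval.

The dynamics is governed by the Moore-Shannon inequality
p (1 - p) f'(p) > f(p) (1 - f(p)) ([moore_shannon_lt]), proved by revealing the
edges one at a time. It says that the odds of f(p), divided by the odds of p,
increase strictly; so f has at most one fixed point p* in (0, 1), and
zeta = f'(p* ) > 1 there. Such a fixed point exists because f is of order
d = dist at 0 and 1 - f is of order Cut at 1, where d and Cut are at least 2: a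
set of open edges that crosses has at least d edges, and a set of closed edges
that separates has at least Cut edges, both bounds being attained
([crossing_poly_s_shaped]).

At the repelling point p*, the equation Psi(zeta x) = f(Psi(x)) with
Psi(0) = p* and Psi'(0) = 1 has a formal power series solution, which is entire:
its majorant is bounded near 0, and the equation itself carries this bound from
t to zeta t ([linearizing_function]). The same equation carries 0 < Psi < 1 and
Psi' > 0 from a neighbourhood of 0 to the whole line, and the orbits of f show
that Psi is onto (0, 1). So Psi is a smooth diffeomorphism and h is its inverse.
The other claims are read off the equation.
- In the coordinate h the k-th iterate of f is multiplication by zeta^k, so
  f_k(p* + l / zeta^k) = Psi(zeta^k h(p* + l / zeta^k)), and the argument of Psi
  tends to l because h'(p* ) = 1 ([iter_rescaled_cvg]). The same computation gives
  uniqueness of h ([linear_conjugation_unique]).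
- Near 0, f is comparable to the power d, so - ln Psi(- x) is multiplied by d, up
  to a bounded error, when x is multiplied by zeta; iterating, it is comparable
  to x^nu with zeta^nu = d ([power_growth], [power_decay]). The other tail is
  the same argument for 1 - Psi, with Cut in place of d. *)

(** * Expectations over independent edges *)

Section Expectation.
Context {T : comNzRingType} {E : finType}.
Implicit Types (p : T) (g : {set E} -> T) (S : {set E}) (e : E) (s : seq E).

(** The scalars form an arbitrary commutative ring: at a real [p] these are
probabilities, at ['X] they are the polynomials whose derivative is needed. *)
Definition weight p S : T := \prod_(e : E) (if e \in S then p else 1 - p).

Definition expect p g : T := \sum_(S : {set E}) weight p S * g S.

Fixpoint resample p s g S : T :=
  if s is e :: s' then
    p * resample p s' g (e |: S) + (1 - p) * resample p s' g (S :\ e)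
  else g S.

Lemma expect1 p : expect p (fun=> 1) = 1.
Proof.
rewrite /expect (eq_bigr (weight p)) => [|S _]; last by rewrite mulr1.
have := @bigA_distr T 0 1 *%R +%R E (fun=> p) (fun=> 1 - p).
rewrite big1 => [->|e _]; last by rewrite /= addrC subrK.
by apply: eq_bigl => S.
Qed.

Lemma expect_cst p c : expect p (fun=> c) = c.
Proof. by rewrite /expect -mulr_suml -[RHS]mul1r -(expect1 p) /expect; congr (_ * _);
  apply: eq_bigr => S _; rewrite mulr1. Qed.

Lemma eq_expect p g g' : g =1 g' -> expect p g = expect p g'.
Proof. by move=> eg; apply: eq_bigr => S _; rewrite eg. Qed.

Lemma sum_setD1 e (F : {set E} -> T) :
  \sum_(S : {set E}) F S = \sum_(S : {set E} | e \notin S) (F S + F (e |: S)).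
Proof.
rewrite (bigID (fun S : {set E} => e \in S)) /= addrC big_split /=; congr (_ + _).
rewrite (reindex_onto (fun S => e |: S) (fun S => S :\ e)) /=; last first.
  by move=> S eS; rewrite finset.setD1K.
apply: eq_bigl => S; rewrite finset.setU11 /=.
apply/eqP/idP => [<-|eS]; first by rewrite !inE eqxx.
by rewrite finset.setU1K.
Qed.

Lemma weightU1 p e S : e \notin S ->
  weight p (e |: S) = p * \prod_(e' | e' != e) (if e' \in S then p else 1 - p).
Proof.
move=> eS; rewrite /weight (bigD1 e) //= finset.setU11; congr (_ * _).
by apply: eq_bigr => e' ne; rewrite !inE (negPf ne).
Qed.

Lemma weightN p e S : e \notin S ->
  weight p S = (1 - p) * \prod_(e' | e' != e) (if e' \in S then p else 1 - p).
Proof. by move=> eS; rewrite /weight (bigD1 e) //= (negPf eS). Qed.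

Lemma expect_resample1 p e g :
  expect p (fun S => p * g (e |: S) + (1 - p) * g (S :\ e)) = expect p g.
Proof.
rewrite /expect !(sum_setD1 e); apply: eq_bigr => S eS.
rewrite (weightU1 _ eS) (weightN _ eS) finset.setUA finset.setUid.
rewrite (finset.setU1K eS); have -> : S :\ e = S.
  by apply/finset.setP => x; rewrite !inE; case: eqVneq => // ->; rewrite (negPf eS).
ring.
Qed.

Lemma expect_resample p s g : expect p (resample p s g) = expect p g.
Proof. by elim: s g => //= e s IH g; rewrite expect_resample1 IH. Qed.

Lemma resample_local p s g S S' :
  (forall e, e \notin s -> (e \in S) = (e \in S')) ->
  resample p s g S = resample p s g S'.
Proof.
elim: s S S' => [|e s IH] S S' eqS /=.
  by congr (g _); apply/finset.setP => e; apply: eqS.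
congr (_ * _ + _ * _); apply: IH => e' e's; rewrite !inE;
  by case: (eqVneq e' e) => //= ne; apply: eqS; rewrite inE negb_or ne.
Qed.

(** Resampling every edge forgets the initial configuration, so an expectation
over independent edges is a sum over edges revealed one at a time: this is
what makes induction over edges possible. *)
Lemma expectE p g S : expect p g = resample p (enum E) g S.
Proof.
rewrite -(expect_resample p (enum E)) -(expect_cst p (resample _ _ _ S)).
by apply: eq_expect => S'; apply: resample_local => e; rewrite mem_enum.
Qed.

End Expectation.

Section Block.
Context {T : comNzRingType} {E F : finType}.
Variables (p : T) (B : pred {set F}).

Definition fiber (S : {set E * F}) (e : E) : {set F} := [set x | (e, x) \in S].

Definition blocks (S : {set E * F}) : {set E} := [set e | B (fiber S e)].

Let glue (u : {ffun E -> {set F}}) : {set E * F} := [set x | x.2 \in u x.1].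

Let glueK : cancel (fun S => [ffun e => fiber S e]) glue.
Proof. by move=> S; apply/finset.setP => -[e x]; rewrite !inE /= ffunE inE. Qed.

Let fiber_glue u e : fiber (glue u) e = u e.
Proof. by apply/finset.setP => x; rewrite !inE. Qed.

Lemma weight_fibers S : weight p S = \prod_e weight p (fiber S e).
Proof.
by rewrite /weight pair_big /=; apply: eq_bigr => -[e x] _; rewrite inE.
Qed.

Lemma sum_fibers (Q : {set E * F} -> T) (W : {ffun E -> {set F}} -> T) :
  (forall S, Q S = W [ffun e => fiber S e]) -> \sum_S Q S = \sum_u W u.
Proof.
move=> QW; rewrite (reindex glue) /=.
  apply: eq_bigr => u _; rewrite QW; congr W.
  by apply/ffunP => e; rewrite ffunE fiber_glue.
exists (fun S => [ffun e => fiber S e]) => [u _|S _]; last exact: glueK.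
by apply/ffunP => e; rewrite ffunE fiber_glue.
Qed.

(** The states of the blocks are independent, each good with the same
probability: conditioning on the set of good blocks factors the weight. *)
Lemma expect_blocks (g : {set E} -> T) :
  expect p (g \o blocks) = expect (expect p (fun S => (B S)%:R)) g.
Proof.
pose good (u : {ffun E -> {set F}}) : {set E} := [set e | B (u e)]%SET.
have -> : expect p (g \o blocks) =
    \sum_(u : {ffun E -> {set F}}) (\prod_e weight p (u e)) * g (good u).
  apply: sum_fibers => S /=; rewrite weight_fibers; congr (_ * g _).
    by apply: eq_bigr => e _; rewrite ffunE.
  by apply/finset.setP => e; rewrite !inE ffunE.
rewrite (partition_big good xpredT) //=; apply: eq_bigr => U _.
rewrite (eq_bigr (fun u : {ffun _} => (\prod_e weight p (u e)) * g U)); last first.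
  by move=> u /eqP ->.
rewrite -mulr_suml; congr (_ * _).
rewrite /weight.
transitivity (\prod_(e : E) \sum_(V : {set F} | B V == (e \in U)) weight p V).
  rewrite bigA_distr_big_dep; apply: eq_bigl => u.
  apply/eqP/familyP => [<- e|goodu]; first by rewrite unfold_in /= inE.
  by apply/finset.setP => e; rewrite inE; apply/eqP; apply: goodu.
apply: eq_bigr => e _; case: ifP => eU.
  rewrite /expect big_mkcond; apply: eq_bigr => V _.
  by case: (B V); rewrite /= ?mulr1 ?mulr0.
rewrite -[X in X - _](expect1 (E := F) p) /expect -sumrB big_mkcond.
apply: eq_bigr => V _; rewrite -mulrBr.
by case: (B V); rewrite /= ?subrr ?subr0 ?mulr1 ?mulr0.
Qed.

End Block.

Section MooreShannon.
Context {R : realType} {E : finType}.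
Variable A : pred {set E}.
Implicit Types (p : R) (S : {set E}) (e : E) (s : seq E).

Hypothesis A_mono : forall S S', S \subset S' -> A S -> A S'.

(** The conditional probability of [A] given the states [S] of the edges outside
[s], as a polynomial in the opening probability. *)
Definition reveal s S : {poly R} := resample 'X s (fun S => (A S)%:R) S.

Lemma reveal_cons s S e :
  reveal (e :: s) S = 'X * reveal s (e |: S) + (1 - 'X) * reveal s (S :\ e).
Proof. by []. Qed.

Lemma reveal_nil S : reveal [::] S = (A S)%:R.
Proof. by []. Qed.

Lemma horner_reveal_cons s S e p :
  (reveal (e :: s) S).[p] = p * (reveal s (e |: S)).[p] + (1 - p) * (reveal s (S :\ e)).[p].
Proof. by rewrite reveal_cons !hornerE. Qed.

Lemma deriv_reveal_cons s S e p :
  (reveal (e :: s) S)^`().[p] =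
    (reveal s (e |: S)).[p] - (reveal s (S :\ e)).[p] +
    (p * (reveal s (e |: S))^`().[p] + (1 - p) * (reveal s (S :\ e))^`().[p]).
Proof. rewrite reveal_cons !poly.derivE !(hornerD, hornerN, hornerM, hornerC, hornerX). ring. Qed.

Lemma horner_nat_bool (b : bool) p : (b%:R : {poly R}).[p] = b%:R.
Proof. by case: b; rewrite hornerE. Qed.

Variable p : R.
Hypothesis p01 : 0 < p < 1.

Lemma reveal_mono s S S' : S \subset S' -> (reveal s S).[p] <= (reveal s S').[p].
Proof.
have /andP[p0 p1] := p01.
elim: s S S' => [|e s IH] S S' sub.
  rewrite !reveal_nil !horner_nat_bool ler_nat.
  by have := A_mono sub; case: (A S) => // ->.
rewrite !horner_reveal_cons; apply: lerD; apply: ler_wpM2l;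
  rewrite ?subr_ge0 ?(ltW p0) ?(ltW p1) //;
  apply: IH; [exact: finset.setUS | exact: finset.setSD].
Qed.

Lemma reveal_ge0 s S : 0 <= (reveal s S).[p].
Proof.
have /andP[p0 p1] := p01.
elim: s S => [|e s IH] S; first by rewrite reveal_nil horner_nat_bool ler0n.
by rewrite horner_reveal_cons addr_ge0 // mulr_ge0 ?IH ?subr_ge0 ?(ltW p0) ?(ltW p1).
Qed.

Lemma reveal_le1 s S : (reveal s S).[p] <= 1.
Proof.
have /andP[p0 p1] := p01.
elim: s S => [|e s IH] S; first by rewrite reveal_nil horner_nat_bool lern1 leq_b1.
rewrite horner_reveal_cons; have := IH (e |: S); have := IH (S :\ e).
by nra.
Qed.

Lemma reveal_gt0 s S : A (S :|: [set:: s]) -> 0 < (reveal s S).[p].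
Proof.
have /andP[p0 p1] := p01.
elim: s S => [|e s IH] S AS.
  by rewrite reveal_nil horner_nat_bool ltr0n; move: AS;
    rewrite finset.set_nil finset.setU0 => ->.
rewrite horner_reveal_cons ltr_wpDr ?mulr_ge0 ?reveal_ge0 ?subr_ge0 ?(ltW p1) //.
rewrite mulr_gt0 // IH //; move: AS; apply: A_mono.
by apply/fintype.subsetP => x; rewrite !inE; case: (x == e); case: (x \in S);
  case: (x \in s).
Qed.

Lemma reveal_lt1 s S : ~~ A (S :\: [set:: s]) -> (reveal s S).[p] < 1.
Proof.
have /andP[p0 p1] := p01.
elim: s S => [|e s IH] S AS.
  by rewrite reveal_nil horner_nat_bool; move: AS;
    rewrite finset.set_nil finset.setD0 => /negPf ->.
rewrite horner_reveal_cons.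
have := reveal_le1 s (e |: S).
have : (reveal s (S :\ e)).[p] < 1.
  apply: IH; apply: contra AS; apply: A_mono.
  by apply/fintype.subsetP => x; rewrite !inE negb_or; case: (x == e);
    case: (x \in S); case: (x \in s).
by nra.
Qed.

Lemma reveal_eq0 s S : ~~ A (S :|: [set:: s]) -> (reveal s S).[p] = 0.
Proof.
elim: s S => [|e s IH] S AS.
  by rewrite reveal_nil horner_nat_bool; move: AS;
    rewrite finset.set_nil finset.setU0 => /negPf ->.
rewrite horner_reveal_cons !IH ?mulr0 ?addr0 //; apply: contra AS; apply: A_mono;
  by apply/fintype.subsetP => x; rewrite !inE; case: (x == e); case: (x \in S);
    case: (x \in s).
Qed.

(** Revealing one edge writes the probability as p f1 + (1 - p) f0 with
f0 <= f1, and the right side minus the left side is the average of the same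
differences for f1 and f0, plus p (1 - p) (f1 - f0) (1 - (f1 - f0)). *)
Lemma moore_shannon_le s S :
  (reveal s S).[p] * (1 - (reveal s S).[p]) <= p * (1 - p) * (reveal s S)^`().[p].
Proof.
have /andP[p0 p1] := p01.
elim: s S => [|e s IH] S.
  rewrite reveal_nil horner_nat_bool -polyC_natr derivC hornerC mulr0.
  by case: (A S); rewrite ?subrr ?mulr0 ?mul0r.
rewrite horner_reveal_cons deriv_reveal_cons.
have := IH (e |: S); have := IH (S :\ e).
have := reveal_ge0 s (S :\ e); have := reveal_le1 s (e |: S).
have : (reveal s (S :\ e)).[p] <= (reveal s (e |: S)).[p].
  apply: reveal_mono; apply: fintype.subset_trans (finset.subsetUr _ _).
  exact: finset.subsetDl.
set f1 := (reveal s (e |: S)).[p]; set f0 := (reveal s (S :\ e)).[p].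
move=> f01 f1le f0ge IH0 IH1.
have q0 : 0 < 1 - p by rewrite subr_gt0.
have := ler_wpM2l (ltW p0) IH1; have := ler_wpM2l (ltW q0) IH0.
have : 0 <= p * (1 - p) * ((f1 - f0) * (1 - (f1 - f0))).
  by rewrite !mulr_ge0 ?(ltW p0) ?(ltW q0) ?subr_ge0 // lerBlDr ler_wpDr.
by nra.
Qed.

(** Close the edges one by one until [A] can no longer hold without the next edge.
Revealing that edge gives f0 = 0 and 0 < f1 < 1, because [A] still holds when all
the remaining edges are open, but not when a single one is; so the extra term of
[moore_shannon_le] is positive. *)
Lemma moore_shannon_lt s S :
  {in s, forall e, ~~ A (e |: (S :\: [set:: s]))} ->
  ~~ A (S :\: [set:: s]) -> A (S :|: [set:: s]) ->
  (reveal s S).[p] * (1 - (reveal s S).[p]) < p * (1 - p) * (reveal s S)^`().[p].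
Proof.
have /andP[p0 p1] := p01.
have q0 : 0 < 1 - p by rewrite subr_gt0.
elim: s S => [|e s IH] S noA1 noA0 yesA.
  by move: noA0 yesA; rewrite finset.set_nil finset.setD0 finset.setU0 => /negPf ->.
rewrite horner_reveal_cons deriv_reveal_cons.
have f01 : (reveal s (S :\ e)).[p] <= (reveal s (e |: S)).[p].
  apply: reveal_mono; apply: fintype.subset_trans (finset.subsetUr _ _).
  exact: finset.subsetDl.
have f1gt : 0 < (reveal s (e |: S)).[p].
  apply: reveal_gt0; move: yesA; apply: A_mono.
  by apply/fintype.subsetP => x; rewrite !inE; case: (x == e); case: (x \in S);
    case: (x \in s).
have f1lt : (reveal s (e |: S)).[p] < 1.
  apply: reveal_lt1; apply: contra (noA1 _ (mem_head _ _)); apply: A_mono.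
  by apply/fintype.subsetP => x; rewrite !inE; case: (x == e); case: (x \in S);
    case: (x \in s).
have f0ge := reveal_ge0 s (S :\ e).
have IH1 := ler_wpM2l (ltW p0) (moore_shannon_le s (e |: S)).
have IH0 := ler_wpM2l (ltW q0) (moore_shannon_le s (S :\ e)).
have [yesA0|noA'] := boolP (A ((S :\ e) :|: [set:: s])).
  have {IH0} IH0 : (1 - p) * ((reveal s (S :\ e)).[p] * (1 - (reveal s (S :\ e)).[p]))
      < (1 - p) * (p * (1 - p) * (reveal s (S :\ e))^`().[p]).
    rewrite ltr_pM2l //; apply: IH => // [e' e's|].
      apply: contra (noA1 e' _); rewrite ?inE ?e's ?orbT //; apply: A_mono.
      by apply/fintype.subsetP => x; rewrite !inE negb_or; case: (x == e');
        case: (x == e); case: (x \in S); case: (x \in s).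
    apply: contra noA0; apply: A_mono.
    by apply/fintype.subsetP => x; rewrite !inE negb_or; case: (x == e);
      case: (x \in S); case: (x \in s).
  have : 0 <= p * (1 - p) * (((reveal s (e |: S)).[p] - (reveal s (S :\ e)).[p]) *
      (1 - ((reveal s (e |: S)).[p] - (reveal s (S :\ e)).[p]))).
    by rewrite !mulr_ge0 ?(ltW p0) ?(ltW q0) ?subr_ge0 // lerBlDr ler_wpDr // ltW.
  move: IH0 IH1; clear; set f1 := (reveal s (e |: S)).[p];
    set f0 := (reveal s (S :\ e)).[p].
  by nra.
have f00 := reveal_eq0 noA'.
have : 0 < p * (1 - p) * ((reveal s (e |: S)).[p] * (1 - (reveal s (e |: S)).[p])).
  by rewrite !mulr_gt0 ?subr_gt0.
move: IH0 IH1; rewrite f00; clear; set f1 := (reveal s (e |: S)).[p].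
by nra.
Qed.

End MooreShannon.

(** * Linking sets, cuts and edge replacement *)

Section BigMin.
Context {I : finType} {x : nat} {P : pred I} {F : I -> nat}.

Lemma bigminn_le j : P j -> (\big[minn/x]_(i | P i) F i <= F j)%N.
Proof.
move=> Pj; rewrite unlock; have : j \in index_enum I by rewrite mem_index_enum.
elim: (index_enum I) => //= i s IH; rewrite inE => /orP[/eqP <-|/IH le_s].
  by rewrite Pj geq_minl.
by case: (P i) => //; apply: leq_trans le_s; apply: geq_minr.
Qed.

Lemma bigminn_attained :
  \big[minn/x]_(i | P i) F i = x \/
  exists2 j, P j & \big[minn/x]_(i | P i) F i = F j.
Proof.
elim/big_rec: _ => [|i m Pi IH]; first by left.
rewrite /minn; case: ifP => _ //.
by right; exists i.
Qed.

End BigMin.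

Section Linking.
Variable G : ograph.
Implicit Types (S : {set edge G}) (x y z : vertex G) (e : edge G).

Lemma joins_sym e x y : joins e x y = joins e y x.
Proof. by rewrite /joins orbC. Qed.

Lemma adj_sym S : symmetric (adj S).
Proof. by move=> x y; apply: eq_existsb => e; rewrite joins_sym. Qed.

Lemma linked_sym S x y : linked S x y = linked S y x.
Proof. exact: sym_connect_sym (@adj_sym S) x y. Qed.

Lemma linked_trans S y x z : linked S x y -> linked S y z -> linked S x z.
Proof. exact: connect_trans. Qed.

Lemma linked_mono S S' x y : S \subset S' -> linked S x y -> linked S' x y.
Proof.
move=> sub; apply: connect_sub => {}x {}y /exists_inP[e eS exy].
by apply: connect1; apply/exists_inP; exists e => //; apply: (fintype.subsetP sub).
Qed.

Lemma linked1 S e x y : e \in S -> joins e x y -> linked S x y.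
Proof. by move=> eS exy; apply: connect1; apply/exists_inP; exists e. Qed.

Lemma linked0 x y : linked finset.set0 x y = (x == y).
Proof.
apply/idP/eqP => [/connectP[[|z p]]|->]; last exact: connect0.
  by move=> _ ->.
by move=> /= /andP[/exists_inP[e]]; rewrite inE.
Qed.

Lemma walk_linked S x p :
  walk x p -> {subset path_edges p <= S} -> linked S x (last x (path_vertices x p)).
Proof.
elim: p x => [|[e z] p IH] x /=; first by move=> _ _; apply: connect0.
move=> /andP[exz wp] sub; apply: (@linked_trans _ z).
  by apply: linked1 exz; apply: sub; rewrite mem_head.
by apply: IH => // e' e'p; apply: sub; rewrite inE e'p orbT.
Qed.

Lemma linked_path S x y : linked S x y ->
  exists2 p, is_path x y p & {subset path_edges p <= S}.
Proof.
move=> /connectP[q0 q0path ->]; case/shortenP: q0path => q qpath quniq _.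
have [p [wp pe pv]] : exists p, [/\ walk x p, {subset path_edges p <= S} &
    [seq s.2 | s <- p] = q].
  elim: q x qpath {quniq} => [|z q IH] x /=; first by move=> _; exists [::].
  move=> /andP[/exists_inP[e eS exz] /IH[p [wp pe pv]]].
  exists ((e, z) :: p); split => /=; rewrite ?exz ?pv //.
  by move=> e'; rewrite inE => /orP[/eqP ->|/pe].
by exists p => //; rewrite /is_path /path_vertices pv wp quniq /= eqxx.
Qed.

Lemma walk_ends x p e : walk x p -> e \in path_edges p ->
  (src e \in path_vertices x p) && (tgt e \in path_vertices x p).
Proof.
elim: p x => [//|[e' z] p IH] x /= /andP[exz wp]; rewrite /path_edges /= inE.
case/orP => [/eqP ->|/(IH _ wp)]; last first.
  by rewrite /path_vertices /= !inE => /andP[-> ->]; rewrite !orbT.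
by rewrite /path_vertices /= !inE; case/orP: exz => /andP[/eqP -> /eqP ->];
  rewrite !eqxx ?orbT.
Qed.

Lemma path_edges_uniq x p :
  walk x p -> uniq (path_vertices x p) -> uniq (path_edges p).
Proof.
elim: p x => [//|[e z] p IH] x /= /andP[exz wp] /andP[xp up].
rewrite (IH _ wp up) andbT.
apply: contra xp => /(walk_ends wp)/andP[].
by case/orP: exz => /andP[/eqP <- /eqP <-].
Qed.

(** A path without repeated vertices uses each of its edges once. *)
Lemma dist_le_linking S x y : linked S x y -> (dist x y <= #|S|)%N.
Proof.
move=> /linked_path[p /and3P[wp lp up] pS].
have szp : (size p < #|vertex G|)%N.
  by have := uniq_leq_size up (fun v _ => mem_enum _ v); rewrite -cardE /= size_map.
apply: (@leq_trans (size p)).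
  apply: (bigminn_le (P := fun n : 'I_ _ => _) (F := val) (j := Ordinal szp)).
  by apply/existsP; exists (in_tuple p); rewrite /is_path wp lp up.
rewrite -(size_map (fun s => s.1)) -(card_uniqP _); last exact: path_edges_uniq wp up.
by apply: subset_leq_card; apply/fintype.subsetP.
Qed.

Lemma linking_of_dist x y : linked [set: edge G] x y ->
  exists2 S, linked S x y & (#|S| <= dist x y)%N.
Proof.
move=> xy; case: (@bigminn_attained _ #|vertex G|
  (fun n : 'I_#|vertex G| => [exists p : n.-tuple _, is_path x y p]) val)
  => [|[n /existsP[p pp]]]; rewrite -/(dist x y) => ->.
  have [p /and3P[wp /eqP lp up] _] := linked_path xy.
  exists [set:: path_edges p]%SET.
    by rewrite -[y]lp; apply: walk_linked => // e; rewrite inE.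
  rewrite cardsE; apply: leq_trans (card_size _) _; rewrite size_map.
  by have := uniq_leq_size up (fun v _ => mem_enum _ v);
    rewrite -cardE /= size_map => /ltnW.
have /and3P[wp /eqP lp up] := pp.
exists [set:: path_edges p]%SET.
  by rewrite -[y]lp; apply: walk_linked => // e; rewrite inE.
by rewrite cardsE; apply: leq_trans (card_size _) _; rewrite size_map size_tuple.
Qed.

Lemma dist_refl x : dist x x = 0%N.
Proof.
apply/eqP; rewrite -leqn0 -(cards0 (edge G)); apply: dist_le_linking.
by rewrite linked0.
Qed.

Lemma Cut_le S : ~~ linked (~: S)%SET (va G) (vb G) -> (Cut G <= #|S|)%N.
Proof. by move=> nS; apply: (bigminn_le (F := fun S : {set edge G} => #|S|)). Qed.

Lemma cut_attained : va G != vb G ->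
  exists2 S : {set edge G}, ~~ linked (~: S)%SET (va G) (vb G) & (#|S| <= Cut G)%N.
Proof.
move=> neq; case: (@bigminn_attained _ #|edge G|
  (fun S : {set edge G} => ~~ linked (~: S)%SET (va G) (vb G)) (fun S => #|S|))
  => [|[S nS]]; rewrite -/(Cut G) => ->; last by exists S.
exists [set: edge G]%SET; last exact: max_card.
by rewrite finset.setCT linked0.
Qed.

(** A single edge lies on at most one of the two paths, and closing it leaves the
other one open. *)
Lemma Cut_gt1 : va G != vb G -> two_edge_disjoint_paths (va G) (vb G) ->
  (1 < Cut G)%N.
Proof.
move=> neq [p [q [pp qp _ disj]]]; have [S nS cS] := cut_attained neq.
apply: leq_trans cS; rewrite ltnNge; apply: contra nS => /card_le1P S1.
have avoid r : is_path (va G) (vb G) r ->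
    (forall e, e \in S -> e \notin path_edges r) -> linked (~: S)%SET (va G) (vb G).
  move=> /and3P[wr /eqP lr _] rS; rewrite -[vb G]lr; apply: walk_linked => // e er.
  by rewrite inE; apply: contraL er; apply: rS.
have [[e eS ep]|noe] := pselect (exists2 e, e \in S & e \in path_edges p).
  apply: avoid qp _ => e' e'S; have := S1 e eS e'; rewrite e'S inE => /esym/eqP ->.
  by apply/negP => eq; apply: (disj e).
by apply: avoid pp _ => e eS; apply/negP => ep; apply: noe; exists e.
Qed.

End Linking.

Section Replacement.
Variables G H : ograph.
Hypothesis Hneq : va H != vb H.

Local Notation GH := (replace_edges G H).
Local Notation good := (blocks (fun S : {set edge H} => linked S (va H) (vb H))).

Lemma repl_emb_va (e : edge G) : repl_emb e (va H) = inl (src e).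
Proof. by rewrite /repl_emb insubN ?eqxx. Qed.

Lemma repl_emb_vb (e : edge G) : repl_emb e (vb H) = inl (tgt e).
Proof. by rewrite /repl_emb insubN ?eqxx ?andbF // eq_sym (negPf Hneq). Qed.

Section Config.
Variable S : {set edge G * edge H}.

Lemma linked_copy (e : edge G) (x y : vertex H) :
  linked (fiber S e) x y -> linked (G := GH) S (repl_emb e x) (repl_emb e y).
Proof.
move=> /connectP[p]; elim: p x => [|z p IH] x /=; first by move=> _ ->; apply: connect0.
move=> /andP[/exists_inP[f fS fxz] pz] yz.
apply: linked_trans (IH _ pz yz); apply: (@linked1 GH _ (e, f)).
  by move: fS; rewrite inE.
by case/orP: fxz => /andP[/eqP <- /eqP <-]; rewrite /joins /= !eqxx ?orbT.
Qed.

Lemma linked_blocks (x y : vertex G) :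
  linked (good S) x y -> linked (G := GH) S (inl x) (inl y).
Proof.
move=> /connectP[p]; elim: p x => [|z p IH] x /=; first by move=> _ ->; apply: connect0.
move=> /andP[/exists_inP[e]]; rewrite inE => /linked_copy.
rewrite repl_emb_va repl_emb_vb => eS exz pz yz.
apply: linked_trans (IH _ pz yz).
by case/orP: exz eS => /andP[/eqP -> /eqP ->] //; rewrite linked_sym.
Qed.

Variable a : vertex G.

(** The vertices reached from [a]: a vertex inside a copy is reached through
one of the two ends of this copy. *)
Let reach_copy (e : edge G) (v : vertex H) : bool :=
  linked (good S) a (src e) && linked (fiber S e) (va H) v ||
  linked (good S) a (tgt e) && linked (fiber S e) (vb H) v.

Let reach (w : vertex GH) : bool :=
  match w with
  | inl x => linked (good S) a x
  | inr ev => reach_copy ev.1 (val ev.2)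
  end.

Let cross e : linked (fiber S e) (va H) (vb H) -> linked (good S) (src e) (tgt e).
Proof.
by move=> ab; apply: (linked1 (e := e)); rewrite ?inE // /joins !eqxx.
Qed.

Let reach_emb e v : reach (repl_emb e v) = reach_copy e v.
Proof.
case: (eqVneq v (va H)) => [->|nva].
  rewrite repl_emb_va /= /reach_copy [linked _ (va H) _]connect0 andbT.
  apply/idP/orP => [->|[//|/andP[at_ ba]]]; first by left.
  by apply: linked_trans at_ _; rewrite linked_sym; apply: cross; rewrite linked_sym.
case: (eqVneq v (vb H)) => [->|nvb].
  rewrite repl_emb_vb /= /reach_copy [linked _ (vb H) _]connect0 andbT.
  apply/idP/orP => [->|[/andP[as_ ab]|//]]; first by right.
  by apply: linked_trans as_ (cross ab).
rewrite /repl_emb; case: insubP => [w _ wv|]; last by rewrite nva nvb.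
by rewrite /= wv.
Qed.

(** [reach] is closed under the open edges of the replaced graph, since inside a
copy it only depends on the cluster of the vertex. *)
Lemma linked_replaceP (y : vertex G) :
  linked (G := GH) S (inl a) (inl y) = linked (good S) a y.
Proof.
apply/idP/idP => [/connectP[p]|/linked_blocks //].
have: reach (inl a) by apply: connect0.
rewrite -[linked _ a y]/(reach (inl y)).
move: (inl a : vertex GH) (inl y : vertex GH) => w w'.
elim: p w => [|z p IH] w rw /=; first by move=> _ ->.
move=> /andP[/exists_inP[[e f] efS] jf pz]; apply: IH pz.
have fS : f \in fiber S e by rewrite inE.
have step (u v v' : vertex H) : joins f v v' ->
    linked (fiber S e) u v = linked (fiber S e) u v'.
  move=> vv'; apply/idP/idP => uv; apply: linked_trans uv _; apply: (linked1 fS) => //.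
  by rewrite joins_sym.
have fj : joins f (src f) (tgt f) by rewrite /joins !eqxx.
have rf : reach (repl_emb e (src f)) = reach (repl_emb e (tgt f)).
  by rewrite !reach_emb /reach_copy !(step _ _ _ fj).
by move: rw; case/orP: jf => /andP[/eqP <- /eqP <-] /=; rewrite rf.
Qed.

End Config.

Lemma perc_probE (K : ograph) (R : realType) (p : R) (A : pred {set edge K}) :
  perc_prob p A = expect p (fun S => (A S)%:R).
Proof.
rewrite /perc_prob /expect big_mkcond; apply: eq_bigr => S _.
by case: (A S); rewrite ?mulr1 ?mulr0.
Qed.

Lemma crossing_prob_replace (R : realType) (p : R) :
  crossing_prob GH p = crossing_prob G (crossing_prob H p).
Proof.
rewrite /crossing_prob !perc_probE.
rewrite -(expect_blocks p (fun S : {set edge H} => linked S (va H) (vb H))).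
by apply: eq_expect => S /=; rewrite linked_replaceP.
Qed.

End Replacement.

Lemma crossing_prob_single_edge (R : realType) (p : R) :
  crossing_prob single_edge p = p.
Proof.
rewrite /crossing_prob perc_probE (expectE _ _ finset.set0).
rewrite (_ : enum _ = [:: tt]); last by rewrite enumT unlock.
rewrite /= (_ : linked _ _ _ = true); last first.
  by apply: (@linked1 single_edge _ tt); rewrite ?inE.
rewrite (_ : linked _ _ _ = false) ?mulr1 ?mulr0 ?addr0 //.
rewrite (_ : (_ :\ _)%SET = finset.set0) ?linked0 //.
by apply/finset.setP => x; rewrite !inE andbF.
Qed.

(** The crossing probability of the k-th hierarchical graph is the k-th iterate
of that of the seed: open each edge of level k - 1 when its copy of the seed
is crossed. *)
Lemma crossing_prob_hgraph (R : realType) (G : ograph) k (p : R) :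
  va G != vb G -> crossing_prob (hgraph G k) p = iter k (@crossing_prob G R) p.
Proof.
move=> neq; elim: k p => [|k IH] p; first exact: crossing_prob_single_edge.
by rewrite [LHS]crossing_prob_replace // IH iterSr.
Qed.

(** * Crossing probabilities are S-shaped polynomials *)

Section Polynomial.
Context {R : realType} {E : finType}.
Implicit Types (p : R) (S : {set E}) (A : pred {set E}).

Lemma horner_resample p s (g : {set E} -> {poly R}) S :
  (resample 'X s g S).[p] = resample p s (fun S => (g S).[p]) S.
Proof.
elim: s S => //= e s IH S.
by rewrite hornerD !hornerM !IH hornerX hornerD hornerN hornerC hornerX.
Qed.

Lemma horner_reveal A p :
  (reveal A (enum E) finset.set0).[p] = expect p (fun S => (A S)%:R).
Proof.
rewrite horner_resample (expectE _ _ finset.set0); congr resample.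
by apply/funext => S; rewrite horner_nat_bool.
Qed.

Lemma weightE p S : weight p S = p ^+ #|S| * (1 - p) ^+ #|(~: S)%SET|.
Proof.
rewrite /weight (bigID (mem S)) /=; congr (_ * _).
  by rewrite -prodr_const; apply: eq_bigr => e ->.
rewrite -prodr_const; apply: eq_big => [e|e /negPf -> //]; by rewrite inE.
Qed.

Lemma weight_ge0 p S : 0 <= p <= 1 -> 0 <= weight p S.
Proof. by case/andP=> p0 p1; rewrite weightE mulr_ge0 ?exprn_ge0 ?subr_ge0. Qed.

(** Exchange open and closed edges. *)
Lemma expect_compl p A :
  1 - expect p (fun S => (A S)%:R) =
    expect (1 - p) (fun S => (~~ A (~: S)%SET)%:R).
Proof.
rewrite -[X in X - _](expect1 (E := E) p) /expect -sumrB.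
rewrite [RHS](reindex_inj (@finset.setC_inj E)) /=; apply: eq_bigr => S _.
have -> : weight (1 - p) (~: S)%SET = weight p S.
  by rewrite !weightE finset.setCK subKr mulrC.
rewrite finset.setCK -mulrBr; congr (_ * _).
by case: (A S); rewrite ?subrr ?subr0.
Qed.

Lemma expect_le_pow p A d : 0 <= p <= 1 -> (forall S, A S -> (d <= #|S|)%N) ->
  expect p (fun S => (A S)%:R) <= 2 ^+ #|E| * p ^+ d.
Proof.
move=> /andP[p0 p1] Ad.
apply: (@le_trans _ _ (\sum_(S : {set E}) p ^+ d)); last first.
  have card_sets : #|{: {set E}}| = (2 ^ #|E|)%N.
    by rewrite -[LHS]cardsT -finset.powersetT card_powerset cardsT.
  by rewrite sumr_const card_sets -[leLHS]mulr_natl natrX.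
apply: ler_sum => S _; have [AS|_] := boolP (A S); last first.
  by rewrite mulr0 exprn_ge0.
rewrite mulr1 weightE -[leRHS]mulr1 ler_pM ?exprn_ge0 ?subr_ge0 //.
  by apply: ler_wiXn2l => //; apply: Ad.
by apply: exprn_ile1; rewrite ?subr_ge0 // gerBl.
Qed.

Lemma expect_ge_pow p A d S : 0 <= p <= 1 -> A S -> (#|S| <= d)%N ->
  p ^+ d * (1 - p) ^+ #|E| <= expect p (fun S => (A S)%:R).
Proof.
move=> p01 AS Sd; have /andP[p0 p1] := p01.
rewrite /expect (bigD1 S) //= AS mulr1 ler_wpDr //.
  by apply: sumr_ge0 => S' _; rewrite mulr_ge0 ?weight_ge0 ?ler0n.
rewrite weightE ler_pM ?exprn_ge0 ?subr_ge0 //.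
  exact: ler_wiXn2l.
by apply: ler_wiXn2l; rewrite ?subr_ge0 ?gerBl // max_card.
Qed.

End Polynomial.

(** Two features of a crossing polynomial matter for its dynamics: its
log-odds increase faster than those of the identity, and it vanishes to order [d]
at 0 and reaches 1 with order [c] at 1. *)
Record s_shaped (R : realType) (F : {poly R}) (d c m : nat) : Prop := SShaped {
  s_shaped_d : (1 < d)%N;
  s_shaped_c : (1 < c)%N;
  s_shaped_itv : forall p, 0 < p < 1 -> 0 < F.[p] < 1;
  s_shaped_odds : forall p, 0 < p < 1 ->
    F.[p] * (1 - F.[p]) < p * (1 - p) * F^`().[p];
  s_shaped_at0 : forall p, 0 <= p <= 1 ->
    p ^+ d * (1 - p) ^+ m <= F.[p] <= 2 ^+ m * p ^+ d;
  s_shaped_at1 : forall p, 0 <= p <= 1 ->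
    (1 - p) ^+ c * p ^+ m <= 1 - F.[p] <= 2 ^+ m * (1 - p) ^+ c
}.

Definition crossing_poly (R : realType) (G : ograph) : {poly R} :=
  reveal (fun S => linked S (va G) (vb G)) (enum (edge G)) finset.set0.

Lemma horner_crossing_poly (R : realType) (G : ograph) (p : R) :
  (crossing_poly R G).[p] = crossing_prob G p.
Proof. by rewrite horner_reveal /crossing_prob perc_probE. Qed.

(** A linking set has at least dist edges and a cut at least Cut edges, both
bounds being attained; these are the two orders of contact. No single edge
crosses, and the crossing of the whole graph does occur, which makes the
Moore-Shannon inequality strict. *)
Lemma crossing_poly_s_shaped (R : realType) (G : ograph) :
  connected_graph G -> (1 < dist (va G) (vb G))%N ->
  two_edge_disjoint_paths (va G) (vb G) ->
  s_shaped (crossing_poly R G) (dist (va G) (vb G)) (Cut G) #|edge G|.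
Proof.
move=> conn d_gt1 paths.
have neq : va G != vb G.
  by apply: contraL d_gt1 => /eqP ->; rewrite dist_refl.
set A := fun S : {set edge G} => linked S (va G) (vb G).
have A_mono (S S' : {set edge G}) : S \subset S' -> A S -> A S' by apply: linked_mono.
have [D AD cD] := linking_of_dist (conn (va G) (vb G)).
have [C AC cC] := cut_attained neq.
have small (S : {set edge G}) : (#|S| <= 1)%N -> ~~ A S.
  by move=> S1; apply/negP => /dist_le_linking /leq_trans/(_ S1); rewrite leqNgt d_gt1.
have all_edges : [set:: enum (edge G)]%SET = [set: edge G]%SET.
  by apply/finset.setP => e; rewrite !inE mem_enum.
have noA0 : ~~ A (finset.set0 :\: [set:: enum (edge G)])%SET.
  by apply: small; rewrite finset.set0D cards0.
have yesA : A (finset.set0 :|: [set:: enum (edge G)])%SET.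
  by rewrite finset.set0U all_edges; apply: conn.
split=> // [|p p01|p p01|p p01|p p01].
- exact: Cut_gt1.
- by rewrite reveal_gt0 ?reveal_lt1.
- apply: moore_shannon_lt => // e _; apply: small.
  by rewrite finset.set0D finset.setU0 cards1.
- rewrite horner_reveal; apply/andP; split.
    exact: expect_ge_pow AD _.
  by apply: expect_le_pow => // S; apply: dist_le_linking.
- have q01 : 0 <= 1 - p <= 1 by rewrite subr_ge0 gerBl andbC.
  rewrite horner_reveal expect_compl -{2}[p](subKr 1); apply/andP; split.
    exact: expect_ge_pow AC _.
  by apply: expect_le_pow => // S; apply: Cut_le.
Qed.

(** * The fixed point of an S-shaped polynomial *)

Section RealDerivatives.
Context {R : realType}.
Implicit Types (f g df : R -> R) (a b x : R).

Lemma is_derive1D f g x a b : is_derive x (1 : R) f a -> is_derive x (1 : R) g b ->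
  is_derive x (1 : R) (fun y => f y + g y) (a + b).
Proof. by move=> fD gD; apply: (is_deriveD fD gD). Qed.

Lemma is_derive1M f g x a b : is_derive x (1 : R) f a -> is_derive x (1 : R) g b ->
  is_derive x (1 : R) (fun y => f y * g y) (a * g x + f x * b).
Proof.
move=> fD gD; have := is_deriveM fD gD.
by move/is_derive_eq; apply; rewrite /GRing.scale /= addrC mulrC.
Qed.

Lemma is_derive1V f x a : f x != 0 -> is_derive x (1 : R) f a ->
  is_derive x (1 : R) (fun y => (f y)^-1) (- a / f x ^+ 2).
Proof.
move=> fx0 fD; have := is_deriveV fx0 fD.
by move/is_derive_eq; apply; rewrite /GRing.scale /= mulNr mulrC mulNr.
Qed.

Lemma derive_gt0_lt f df a b : a < b ->
  (forall x, a <= x <= b -> is_derive x 1 f (df x)) ->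
  (forall x, a < x < b -> 0 < df x) -> f a < f b.
Proof.
move=> ab fD dfp.
have [x|x|c /[!in_itv]/= cab fab] := @MVT R f df a b ab.
- by rewrite in_itv /= => /andP[ax xb]; apply: fD; rewrite !ltW.
- apply: derivable_within_continuous => {}x.
  by rewrite in_itv /= => xab; have [] := fD x xab.
- by rewrite -subr_gt0 fab mulr_gt0 ?dfp ?subr_gt0.
Qed.

Lemma IVT_lt f a b v : a < b -> continuous f -> f a < v < f b ->
  exists2 x, a < x < b & f x = v.
Proof.
move=> ab fC /andP[av vb].
have [|x] := IVT (ltW ab) (continuous_subspaceT fC) (v := v).
  by rewrite ge_min le_max (ltW av) (ltW vb) orbT.
rewrite in_itv /= => /andP[ax xb] fx; exists x => //.
rewrite !lt_neqAle ax xb !andbT; apply/andP; split; apply/eqP => eqx.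
  by move: av; rewrite eqx fx ltxx.
by move: vb; rewrite -eqx fx ltxx.
Qed.

End RealDerivatives.

Section FixedPoint.
Context {R : realType} {F : {poly R}} {d c m : nat}.
Hypothesis Fs : s_shaped F d c m.
Implicit Types p q x : R.

Lemma s_shaped_deriv_gt0 p : 0 < p < 1 -> 0 < F^`().[p].
Proof.
move=> p01; have /andP[p0 p1] := p01; have /andP[F0 F1] := s_shaped_itv Fs p01.
have := s_shaped_odds Fs p01; have : 0 < F.[p] * (1 - F.[p])
  by rewrite mulr_gt0 ?subr_gt0.
move=> /lt_trans lt0 /lt0; rewrite pmulr_rgt0 // mulr_gt0 // subr_gt0 //.
Qed.

Lemma s_shaped_lt_at0 : exists2 p, 0 < p < 1 & F.[p] < p.
Proof.
have M1 : 1 <= 2 ^+ m :> R by rewrite exprn_ege1 // ler1n.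
have M0 : 0 < 2 ^+ m :> R by rewrite exprn_gt0.
(* With this p, 2^m p^2 = p / 2. *)
pose p : R := (2 * 2 ^+ m)^-1.
have p0 : 0 < p by rewrite invr_gt0 mulr_gt0.
have Mp : 2 ^+ m * p = 2^-1 by rewrite /p invfM mulrCA mulfV ?mulr1 ?gt_eqF.
have p1 : p < 1 by rewrite invf_lt1 ?mulr_gt0 //; lra.
exists p; first by rewrite p0.
have p01 : 0 <= p <= 1 by rewrite !ltW.
have /andP[_ Fp] := s_shaped_at0 Fs p01.
apply: le_lt_trans Fp _.
apply: (@le_lt_trans _ _ (2 ^+ m * p ^+ 2)).
  rewrite ler_pM2l //; apply: ler_wiXn2l; rewrite ?ltW //.
  exact: s_shaped_d Fs.
by rewrite expr2 mulrA Mp gtr_pMl // invf_lt1 // ltr1n.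
Qed.

Lemma s_shaped_gt_at1 : exists2 p, 0 < p < 1 & p < F.[p].
Proof.
have M1 : 1 <= 2 ^+ m :> R by rewrite exprn_ege1 // ler1n.
have M0 : 0 < 2 ^+ m :> R by rewrite exprn_gt0.
pose p : R := (2 * 2 ^+ m)^-1.
have p0 : 0 < p by rewrite invr_gt0 mulr_gt0.
have Mp : 2 ^+ m * p = 2^-1 by rewrite /p invfM mulrCA mulfV ?mulr1 ?gt_eqF.
have p1 : p < 1 by rewrite invf_lt1 ?mulr_gt0 //; lra.
have q01 : 0 <= 1 - p <= 1 by rewrite subr_ge0 gerBl !ltW.
exists (1 - p); first by rewrite subr_gt0 gtrBl p0 p1.
have /andP[_] := s_shaped_at1 Fs q01; rewrite subKr => Fp.
suff : 1 - F.[1 - p] < p by lra.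
apply: le_lt_trans Fp _.
apply: (@le_lt_trans _ _ (2 ^+ m * p ^+ 2)).
  rewrite ler_pM2l //; apply: ler_wiXn2l; rewrite ?ltW //.
  exact: s_shaped_c Fs.
by rewrite expr2 mulrA Mp gtr_pMl // invf_lt1 // ltr1n.
Qed.

(** The derivative of this quotient of odds has the sign of
p (1 - p) F'(p) - F(p) (1 - F(p)); the quotient is 1 at the fixed points. *)
Lemma s_shaped_odds_lt p q : 0 < p -> p < q -> q < 1 ->
  F.[p] * (1 - p) / (p * (1 - F.[p])) < F.[q] * (1 - q) / (q * (1 - F.[q])).
Proof.
move=> p0 pq q1.
pose a : {poly R} := F * (1 - 'X); pose b : {poly R} := 'X * (1 - F).
have aE x : a.[x] = F.[x] * (1 - x) by rewrite /a !(hornerM, hornerD, hornerN, hornerC, hornerX).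
have bE x : b.[x] = x * (1 - F.[x]) by rewrite /b !(hornerM, hornerD, hornerN, hornerC, hornerX).
rewrite -!aE -!bE.
have itv x : p <= x <= q -> 0 < x < 1.
  by case/andP=> px xq; rewrite (lt_le_trans p0) //= (le_lt_trans xq).
have b0 x : p <= x <= q -> b.[x] != 0.
  move=> /itv x01; have /andP[F0 F1] := s_shaped_itv Fs x01; case/andP: x01 => x0 x1.
  by rewrite bE mulf_neq0 ?gt_eqF // subr_gt0.
apply: (derive_gt0_lt (f := fun x => a.[x] * b.[x]^-1)
  (df := fun x => (a^`().[x] * b.[x] - a.[x] * b^`().[x]) / b.[x] ^+ 2)) => // x.
  move=> xpq; have bx0 := b0 x xpq.
  have dV := is_derive1V bx0 (is_derive_poly b x).
  apply: (is_derive_eq (is_derive1M (is_derive_poly a x) dV)).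
  by field.
case/andP=> px xq; have xpq : p <= x <= q by rewrite !ltW.
have x01 := itv x xpq; have bx0 := b0 x xpq.
rewrite mulr_gt0 // ?invr_gt0 ?exprn_even_gt0 //.
have := s_shaped_odds Fs x01.
rewrite aE bE /a /b !poly.derivE !(hornerM, hornerD, hornerN, hornerC, hornerX).
set f := F.[x]; set f' := F^`().[x] => lt_odds.
suff -> : (f' * (1 - x) + f * (0 - 1)) * (x * (1 - f)) -
  f * (1 - x) * (1 * (1 - f) + x * (0 - f')) = x * (1 - x) * f' - f * (1 - f).
  by rewrite subr_gt0.
ring.
Qed.

Lemma s_shaped_fixed_cmp p x : 0 < p < 1 -> F.[p] = p -> 0 < x < 1 ->
  (x < p -> F.[x] < x) /\ (p < x -> x < F.[x]).
Proof.
move=> /andP[p0 p1] Fp x01; have /andP[x0 x1] := x01.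
have /andP[F0 F1] := s_shaped_itv Fs x01.
have odds1 : F.[p] * (1 - p) / (p * (1 - F.[p])) = 1.
  by rewrite Fp divff // mulf_neq0 ?gt_eqF // subr_gt0.
have den : 0 < x * (1 - F.[x]) by rewrite mulr_gt0 ?subr_gt0.
split=> [xp|px].
  have := s_shaped_odds_lt x0 xp p1; rewrite odds1 ltr_pdivrMr //; lra.
have := s_shaped_odds_lt p0 px x1; rewrite odds1 ltr_pdivlMr //; lra.
Qed.

Lemma s_shaped_fixed_unique p q :
  0 < p < 1 -> F.[p] = p -> 0 < q < 1 -> F.[q] = q -> q = p.
Proof.
move=> p01 Fp q01 Fq; have [lt gt] := s_shaped_fixed_cmp p01 Fp q01.
by case: (ltgtP q p) => // [/lt|/gt]; rewrite Fq ltxx.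
Qed.

Lemma s_shaped_fixed_ex : exists2 p, 0 < p < 1 & F.[p] = p.
Proof.
have [p /andP[p0 p1] Fp] := s_shaped_lt_at0; have [q /andP[q0 q1] Fq] := s_shaped_gt_at1.
(* If q < p, a fixed point between them contradicts F(p) < p. *)
have pq : p < q.
  have [//|qp|eq] := ltgtP p q; last by move: Fp; rewrite eq => /(lt_trans Fq);
    rewrite ltxx.
  have hC : continuous (horner ('X - F)) by apply: continuous_horner.
  have [|x /andP[qx xp]] := IVT_lt qp hC (v := 0).
    by rewrite !hornerE subr_lt0 subr_gt0 Fq.
  rewrite !hornerE => /subr0_eq Fx.
  have x01 : 0 < x < 1 by rewrite (lt_trans q0) //= (lt_trans xp).
  have [_ /(_ xp)] := s_shaped_fixed_cmp x01 (esym Fx) (introT andP (conj p0 p1)).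
  by move=> /(lt_trans Fp); rewrite ltxx.
have hC : continuous (horner (F - 'X)) by apply: continuous_horner.
have [|x /andP[px xq]] := IVT_lt pq hC (v := 0).
  by rewrite !hornerE subr_lt0 subr_gt0 Fq Fp.
rewrite !hornerE => /subr0_eq Fx; exists x => //.
by rewrite (lt_trans p0) //= (lt_trans xq).
Qed.

Lemma s_shaped_multiplier_gt1 p : 0 < p < 1 -> F.[p] = p -> 1 < F^`().[p].
Proof.
move=> p01 Fp; have := s_shaped_odds Fs p01; case/andP: p01 => p0 p1.
by rewrite Fp -[X in X < _]mulr1 ltr_pM2l // mulr_gt0 ?subr_gt0.
Qed.

End FixedPoint.

(** * Entire power series *)

Lemma expr_unbounded (R : realType) (z M : R) : 1 < z -> exists n, M <= z ^+ n.
Proof.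
move=> z1; have z0 : 0 < z by apply: lt_trans z1.
have : `|z^-1| < 1 by rewrite gtr0_norm ?invr_gt0 // invf_lt1.
move=> /cvg_expr/cvgrPdist_lt/(_ (`|M| + 1)^-1).
rewrite invr_gt0 ltr_wpDl // => /(_ isT)[n _ /(_ n (leqnn n))] /=.
rewrite sub0r normrN ger0_norm ?exprn_ge0 ?invr_ge0 ?(ltW z0) // exprVn.
rewrite ltf_pV2 ?posrE ?exprn_gt0 // ?ltr_wpDl // => /ltW; exists n.
by apply: le_trans (ler_norm M) _; lra.
Qed.

Section Entire.
Context {R : realType}.
Implicit Types (u : R^nat) (x : R).

Definition entire u := forall x, cvgn (pseries u x).

Lemma entire_norm u : entire u -> entire (fun i => `|u i|).
Proof.
move=> eu x; apply: (is_cvg_pseries_inside_norm (eu (`|x| + 1))).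
by rewrite [ltRHS]ger0_norm ?addr_ge0 // ltrDl.
Qed.

Lemma entire_bounded_norm u :
  (forall x, 0 <= x -> exists B, forall n, \sum_(i < n) `|u i| * x ^+ i <= B) ->
  entire u.
Proof.
move=> bu x; apply: normed_cvg.
have [B uB] := bu _ (normr_ge0 x).
apply: nondecreasing_is_cvgn.
  by apply/nondecreasing_series => i _ _; apply: normr_ge0.
exists B => _ [n _ <-]; rewrite /normed_series_of /series /= big_mkord.
by apply: le_trans (uB n); apply: ler_sum => i _; rewrite normrM normrX.
Qed.

Lemma entire_bound u x : entire u -> 0 <= x ->
  exists B, forall n, \sum_(i < n) `|u i| * x ^+ i <= B.
Proof.
move=> /entire_norm eu x0; exists (limn (pseries (fun i => `|u i|) x)) => n.
have -> : \sum_(i < n) `|u i| * x ^+ i = pseries (fun i => `|u i|) x n.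
  by rewrite /pseries /series /= big_mkord.
apply: nondecreasing_cvgn_le; last exact: eu.
by apply/nondecreasing_series => i _ _; rewrite mulr_ge0 ?exprn_ge0.
Qed.

(** Passing from x to y = 2 x + 1 absorbs the factor i + 1, which is at most
2^(i + 1). *)
Lemma entire_diffs u : entire u -> entire (pseries_diffs u).
Proof.
move=> eu; apply: entire_bounded_norm => x x0; pose y : R := 2 * x + 1.
have y1 : 1 <= y by rewrite lerDr mulr_ge0.
have y0 : 0 <= y by apply: le_trans y1.
have [B uB] := entire_bound eu y0; exists (2 * B) => n.
have := uB n.+1; rewrite big_ord_recl /= => /(le_trans _) sumB.
apply: (@le_trans _ _ (2 * \sum_(i < n) `|u i.+1| * y ^+ i.+1)); last first.
  by rewrite ler_pM2l //; apply: sumB; rewrite lerDr mulr_ge0 ?exprn_ge0.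
rewrite mulr_sumr; apply: ler_sum => i _.
rewrite /pseries_diffs normrM [`|i.+1%:R|]ger0_norm //.
rewrite -mulrA [leRHS]mulrCA [leLHS]mulrCA ler_wpM2l //.
apply: (@le_trans _ _ (2 * (2 ^+ i * x ^+ i))).
  rewrite mulrA -exprS ler_wpM2r ?exprn_ge0 // -natrX ler_nat.
  by apply: ltnW; apply: ltn_expl.
rewrite ler_pM2l // -exprMn; apply: (@le_trans _ _ (y ^+ i)).
  by rewrite lerXn2r ?qualifE /= ?mulr_ge0 // lerDl.
by rewrite exprS ler_peMl // exprn_ge0.
Qed.

Lemma entire_is_derive u x : entire u ->
  is_derive x (1 : R) (fun x => limn (pseries u x)) (limn (pseries (pseries_diffs u) x)).
Proof.
move=> eu; apply: (pseries_snd_diffs (K := `|x| + 1)) => //.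
- exact: entire_diffs.
- by do 2!apply: entire_diffs.
- by rewrite [ltRHS]ger0_norm ?addr_ge0 // ltrDl.
Qed.

Lemma pseries_at0 u : limn (pseries u 0) = u 0%N.
Proof.
apply/cvg_lim => //; rewrite -cvg_shiftS.
rewrite (_ : [sequence _]_n = cst (u 0%N)); first exact: cvg_cst.
apply/funext => n; rewrite /pseries /series /= big_nat_recl //= expr0 mulr1 big1 ?addr0 // => i _.
by rewrite expr0n mulr0.
Qed.

End Entire.

(** * Majorants of polynomials *)

Section Majorant.
Context {R : realType}.
Implicit Types (p q r : {poly R}).

Definition abs_poly p : {poly R} := map_poly Num.norm p.

Definition majorized p q := forall i, `|p`_i| <= q`_i.

Lemma coef_abs_poly p i : (abs_poly p)`_i = `|p`_i|.
Proof. by rewrite coef_map_id0 ?normr0. Qed.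

Lemma size_abs_poly p : size (abs_poly p) = size p.
Proof.
have [->|p0] := eqVneq p 0; first by rewrite /abs_poly map_poly0.
by rewrite size_map_poly_id0 // normr_eq0 lead_coef_eq0.
Qed.

Lemma majorized_abs p : majorized p (abs_poly p).
Proof. by move=> i; rewrite coef_abs_poly. Qed.

Lemma majorized_ge0 p q i : majorized p q -> 0 <= q`_i.
Proof. by move=> pq; apply: le_trans (pq i). Qed.

Lemma majorizedD p q p' q' :
  majorized p q -> majorized p' q' -> majorized (p + p') (q + q').
Proof. by move=> pq pq' i; rewrite !coefD (le_trans (ler_normD _ _)) // lerD. Qed.

Lemma majorizedZ p q a b : `|a| <= b -> majorized p q -> majorized (a *: p) (b *: q).
Proof. by move=> ab pq i; rewrite !coefZ normrM ler_pM. Qed.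

Lemma majorized0 : majorized 0 0.
Proof. by move=> i; rewrite coef0 normr0. Qed.

Lemma majorizedM p q p' q' :
  majorized p q -> majorized p' q' -> majorized (p * p') (q * q').
Proof.
move=> pq pq' i; rewrite !coefM (le_trans (ler_norm_sum _ _ _)) // ler_sum // => j _.
by rewrite normrM ler_pM.
Qed.

Lemma majorizedX p q n : majorized p q -> majorized (p ^+ n) (q ^+ n).
Proof.
move=> pq; elim: n => [|n IH]; last by rewrite !exprS; apply: majorizedM.
by move=> i; rewrite !expr0 coefC; case: ifP; rewrite ?normr1 ?normr0.
Qed.

Lemma majorized_comp p q r :
  majorized q r -> majorized (p \Po q) (abs_poly p \Po r).
Proof.
move=> qr; rewrite !comp_polyE size_abs_poly.
apply: (big_ind2 majorized); [exact: majorized0 | exact: majorizedD |].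
by move=> i _; apply: majorizedZ; rewrite ?coef_abs_poly //; apply: majorizedX.
Qed.

Definition nneg_poly p := forall i, 0 <= p`_i.

Lemma nneg_abs_poly p : nneg_poly (abs_poly p).
Proof. by move=> i; rewrite coef_abs_poly. Qed.

Lemma horner_nneg p x : nneg_poly p -> 0 <= x -> 0 <= p.[x].
Proof.
by move=> p0 x0; rewrite horner_coef sumr_ge0 // => i _; rewrite mulr_ge0 ?exprn_ge0.
Qed.

Lemma horner_nneg_mono p x y : nneg_poly p -> 0 <= x -> x <= y -> p.[x] <= p.[y].
Proof.
move=> p0 x0 xy; rewrite !horner_coef ler_sum // => i _; rewrite ler_wpM2l //.
by rewrite lerXn2r // qualifE /= // (le_trans x0).
Qed.

Lemma partial_sum_nneg p n x : nneg_poly p -> 0 <= x ->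
  \sum_(i < n) p`_i * x ^+ i <= p.[x].
Proof.
move=> p0 x0; rewrite (horner_coef_wide _ (leq_maxr n (size p))).
rewrite -[leLHS](big_mkord xpredT (fun i => p`_i * x ^+ i)).
rewrite -[leRHS](big_mkord xpredT (fun i => p`_i * x ^+ i)).
rewrite [leRHS](big_cat_nat (leq0n _) (leq_maxl n (size p))) /= lerDl.
by rewrite sumr_ge0 // => i _; rewrite mulr_ge0 ?exprn_ge0.
Qed.

(** Evaluating a majorant at twice the point gains a factor 2 per degree. *)
Lemma horner_high_order p q n (x : R) : majorized p q ->
  (forall i, (i < n)%N -> p`_i = 0) -> `|p.[x]| <= 2 ^- n * q.[2 * `|x|].
Proof.
move=> pq p0; rewrite mulrC ler_pdivlMr ?exprn_gt0 // horner_coef.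
apply: le_trans (partial_sum_nneg (size p) (fun i => majorized_ge0 i pq) _);
  last by rewrite mulr_ge0.
rewrite mulrC -ler_pdivlMl ?exprn_gt0 // (le_trans (ler_norm_sum _ _ _)) //.
rewrite mulr_sumr ler_sum // => i _; rewrite ler_pdivlMl ?exprn_gt0 //.
have [ltin|lein] := ltnP i n.
  by rewrite p0 // mul0r normr0 mulr0 mulr_ge0 ?(majorized_ge0 i pq) ?exprn_ge0 ?mulr_ge0.
rewrite normrM normrX exprMn mulrCA ler_pM ?mulr_ge0 ?exprn_ge0 //.
by rewrite ler_wpM2r ?exprn_ge0 // ler_weXn2l // ler1n.
Qed.

End Majorant.

(** * Linearization of a polynomial at a repelling fixed point *)

Section Linearization.
Context {R : realType}.
Variables (zeta : R) (H : {poly R}).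
Hypothesis zeta_gt1 : 1 < zeta.

Let N : {poly R} := 'X^2 * H.
Let F : {poly R} := zeta *: 'X + N.

Let zeta_gt0 : 0 < zeta. Proof. exact: lt_trans zeta_gt1. Qed.

(** The next coefficient of the formal solution of Phi(zeta x) = F(Phi(x)). *)
Definition next_coef (n : nat) (phi : {poly R}) : R :=
  if n == 1%N then 1 else (N \Po phi)`_n / (zeta ^+ n - zeta).

Fixpoint lin_trunc (n : nat) : {poly R} :=
  if n is k.+1 then lin_trunc k + next_coef k (lin_trunc k) *: 'X^k else 0.

Definition lin_coef (n : nat) : R := next_coef n (lin_trunc n).

Lemma coef_lin_trunc n i : (lin_trunc n)`_i = if (i < n)%N then lin_coef i else 0.
Proof.
elim: n => [|n IH] /=; first by rewrite coef0.
rewrite coefD coefZ coefXn IH; case: (ltngtP i n) => [lt|gt|->].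
- by rewrite ltnS ltnW // mulr0 addr0.
- by rewrite ltnS leqNgt gt mulr0 addr0.
- by rewrite ltnSn mulr1 add0r.
Qed.

Lemma lin_coef1 : lin_coef 1 = 1.
Proof. by []. Qed.

Lemma compN phi : N \Po phi = phi ^+ 2 * (H \Po phi).
Proof. by rewrite /N comp_polyM comp_Xn_poly. Qed.

Lemma lin_coef0 : lin_coef 0 = 0.
Proof. by rewrite /lin_coef /next_coef /= compN expr0n /= mul0r coef0 mul0r. Qed.

Lemma lin_trunc_dvdX n : exists q, lin_trunc n = q * 'X.
Proof.
have /factor_theorem[q ->] : root (lin_trunc n) 0; last by exists q; rewrite subr0.
rewrite /root horner_coef0 coef_lin_trunc.
by case: ifP => // _; rewrite lin_coef0.
Qed.

Lemma lin_trunc_agree i n : (i <= n)%N -> exists q, lin_trunc n - lin_trunc i = q * 'X^i.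
Proof.
elim: n => [|n IH]; first by case: i => // _; exists 0; rewrite subrr mul0r.
rewrite leq_eqVlt => /orP[/eqP ->|]; first by exists 0; rewrite subrr mul0r.
rewrite ltnS => le_in; have [q eq] := IH le_in.
exists (q + lin_coef n *: 'X^(n - i)); rewrite mulrDl -eq /= -scalerAl -exprD subnK //.
by rewrite addrAC.
Qed.

Lemma comp_poly_agree (p phi psi : {poly R}) :
  exists q, (p \Po phi) - (p \Po psi) = q * (phi - psi).
Proof.
elim/poly_ind: p => [|p c [q eq]]; first by exists 0; rewrite !comp_poly0 subrr mul0r.
exists (q * phi + (p \Po psi)); rewrite !comp_poly_MXaddC mulrDl mulrAC -eq; ring.
Qed.

(** Since N vanishes to order 2, its composite with a series without constant
term depends, in degree at most i, only on the coefficients of degree below i. *)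
Lemma coef_compN_trunc i n : (i <= n)%N -> (N \Po lin_trunc n)`_i = (N \Po lin_trunc i)`_i.
Proof.
move=> le_in; apply/eqP; rewrite -subr_eq0 -coefB !compN.
have [q agree] := lin_trunc_agree le_in.
have [r agreeH] := comp_poly_agree H (lin_trunc n) (lin_trunc i).
have [qn En] := lin_trunc_dvdX n; have [qi Ei] := lin_trunc_dvdX i.
set phi := lin_trunc n in agree agreeH En *; set psi := lin_trunc i in agree agreeH Ei *.
have -> : phi ^+ 2 * (H \Po phi) - psi ^+ 2 * (H \Po psi) =
    (phi - psi) * (phi * (phi * r) + (phi + psi) * (H \Po psi)).
  transitivity (phi ^+ 2 * ((H \Po phi) - (H \Po psi)) + (phi ^+ 2 - psi ^+ 2) * (H \Po psi)).
    by ring.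
  by rewrite agreeH; ring.
rewrite agree; move: (H \Po psi) => y.
have -> : phi * (phi * r) + (phi + psi) * y = 'X * (qn * (qn * 'X * r) + (qn + qi) * y).
  by rewrite En Ei; ring.
by rewrite mulrA -[_ * 'X^i * 'X]mulrA -exprSr mulrAC coefMXn ltnSn.
Qed.

Lemma lin_coef_eq i n : (i <= n)%N ->
  (zeta ^+ i - zeta) * lin_coef i = (N \Po lin_trunc n)`_i.
Proof.
move=> /coef_compN_trunc ->; rewrite /lin_coef /next_coef.
case: eqP => [->|/eqP i1].
  rewrite expr1 subrr mul0r compN.
  by have [q ->] := lin_trunc_dvdX 1; rewrite exprMn -mulrA mulrC -mulrA coefXnM.
rewrite mulrC divfK // subr_eq0 -[X in _ == X]expr1.
by rewrite (inj_eq (ieexprIn zeta_gt0 (negbT (gt_eqF zeta_gt1)))).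
Qed.

Lemma coef_compF n i : (i < n)%N -> (F \Po lin_trunc n)`_i = zeta ^+ i * lin_coef i.
Proof.
move=> lt_in; rewrite /F comp_polyD comp_polyZ comp_polyX coefD coefZ.
by rewrite -(lin_coef_eq (ltnW lt_in)) coef_lin_trunc lt_in; ring.
Qed.

(** The least constant K with zeta^i <= K (zeta^i - zeta) for all i >= 2. *)
Definition maj_const : R := zeta / (zeta - 1).

Let K_gt0 : 0 < maj_const.
Proof. by rewrite divr_gt0 ?subr_gt0. Qed.

Lemma lin_coef_le i n : (i <= n)%N ->
  `|lin_coef i| * zeta ^+ i <=
    (zeta *: 'X + maj_const *: (abs_poly N \Po abs_poly (lin_trunc n)))`_i.
Proof.
move=> le_in; have maj := majorized_comp N (majorized_abs (lin_trunc n)) i.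
rewrite -(lin_coef_eq le_in) in maj.
rewrite coefD !coefZ coefX; case: i le_in maj => [|[|i]] le_in maj.
- rewrite lin_coef0 normr0 mul0r mulr0 add0r mulr_ge0 ?(ltW K_gt0) //.
  by apply: le_trans maj.
- rewrite lin_coef1 normr1 mul1r mulr1 lerDl mulr_ge0 ?(ltW K_gt0) //.
  by apply: le_trans maj.
rewrite mulr0 add0r; apply: (@le_trans _ _ (maj_const *
  `|(zeta ^+ i.+2 - zeta) * lin_coef i.+2|)); last first.
  by rewrite ler_wpM2l // ltW.
have z1 : 1 <= zeta ^+ i by rewrite exprn_ege1 // ltW.
have gap : 0 <= zeta ^+ i.+2 - zeta.
  by rewrite subr_ge0 -[X in X <= _]expr1 ler_weXn2l // ltW.
rewrite [in leRHS]normrM (ger0_norm gap) [leRHS]mulrA [leLHS]mulrC;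
  apply: ler_wpM2r => //.
rewrite /maj_const mulrAC ler_pdivlMr ?subr_gt0 //.
have : zeta ^+ 2 <= zeta ^+ i.+2 by rewrite ler_weXn2l // ltW.
by rewrite expr2; nra.
Qed.

Let A n := abs_poly (lin_trunc n).

Lemma hornerA n (t : R) : (A n).[t] = \sum_(i < n) `|lin_coef i| * t ^+ i.
Proof.
rewrite (@horner_coef_wide _ n _).
  by apply: eq_bigr => i _; rewrite coef_abs_poly coef_lin_trunc ltn_ord.
rewrite size_abs_poly; apply/leq_sizeP => j lenj.
by rewrite coef_lin_trunc ltnNge lenj.
Qed.

Lemma lin_majorant_step n t : 0 <= t ->
  (A n.+1).[zeta * t] <= zeta * t + maj_const * (abs_poly N).[(A n).[t]].
Proof.
move=> t0; rewrite hornerA.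
pose Q := zeta *: 'X + maj_const *: (abs_poly N \Po A n).
have -> : zeta * t + maj_const * (abs_poly N).[(A n).[t]] = Q.[t].
  by rewrite /Q hornerD !hornerZ hornerX horner_comp.
have Q0 : nneg_poly Q.
  move=> i; rewrite coefD !coefZ coefX.
  apply: addr_ge0; apply: mulr_ge0; rewrite ?ler0n //; [exact: ltW | exact: ltW |].
  exact: majorized_ge0 i (majorized_comp N (majorized_abs _)).
apply: le_trans (partial_sum_nneg n.+1 Q0 t0); apply: ler_sum => i _.
rewrite exprMn mulrA ler_wpM2r ?exprn_ge0 //.
by apply: lin_coef_le; rewrite -ltnS.
Qed.

Lemma horner_absN t : 0 <= t -> t <= 1 ->
  (abs_poly N).[t] <= t ^+ 2 * (abs_poly H).[1].
Proof.
move=> t0 t1.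
have -> : abs_poly N = 'X^2 * abs_poly H.
  apply/polyP => i; rewrite coef_abs_poly /N !coefXnM.
  by case: ifP; rewrite ?normr0 // coef_abs_poly.
rewrite hornerM hornerXn ler_wpM2l ?exprn_ge0 //.
exact: horner_nneg_mono (nneg_abs_poly H) t0 t1.
Qed.

Lemma lin_majorant_near0 : exists2 delta, 0 < delta & forall n, (A n).[delta] <= 2 * delta.
Proof.
set h := (abs_poly H).[1].
have h0 : 0 <= h by apply: horner_nneg; [exact: nneg_abs_poly|].
have Kh0 : 0 <= maj_const * h by rewrite mulr_ge0 ?(ltW K_gt0).
(* With this delta, delta + K h (2 delta)^2 <= 2 delta. *)
have den : 0 < 2 + 4 * (maj_const * h) by lra.
pose delta := (2 + 4 * (maj_const * h))^-1.
have d0 : 0 < delta by rewrite invr_gt0.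
have dE : 2 * delta + 4 * (maj_const * h) * delta = 1.
  by rewrite -mulrDl mulfV ?gt_eqF.
have Khd : 0 <= maj_const * h * delta by rewrite mulr_ge0 // ltW.
exists delta => //; elim=> [|n IH].
  by rewrite hornerA big_ord0 mulr_ge0 // ltW.
have t0 : 0 <= delta / zeta by rewrite divr_ge0 ?ltW.
have An0 x : 0 <= x -> 0 <= (A n).[x] by apply: horner_nneg; apply: nneg_abs_poly.
have dz : delta / zeta <= delta by rewrite ler_pdivrMr // ler_peMr ?ltW.
have := lin_majorant_step n t0; rewrite mulrC divfK ?gt_eqF // => step.
apply: le_trans step _.
have le2 : (A n).[delta / zeta] <= 2 * delta.
  by apply: le_trans IH; apply: horner_nneg_mono => //; apply: nneg_abs_poly.
have : (abs_poly N).[(A n).[delta / zeta]] <= (2 * delta) ^+ 2 * h.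
  apply: (@le_trans _ _ (abs_poly N).[2 * delta]).
    by apply: horner_nneg_mono => //; [exact: nneg_abs_poly | exact: An0].
  by apply: horner_absN; [rewrite mulr_ge0 ?ltW | lra].
move=> /(ler_wpM2l (ltW K_gt0)) /(lerD (lexx delta))/le_trans; apply.
have -> : maj_const * ((2 * delta) ^+ 2 * h) = delta * (4 * (maj_const * h * delta))
  by ring.
have : delta * (4 * (maj_const * h * delta)) <= delta * 1.
  by rewrite ler_wpM2l ?ltW //; lra.
lra.
Qed.

(** The functional equation transports the bound from t to zeta t, so the
formal solution, which converges near 0, is entire. *)
Lemma lin_majorant_bounded t : 0 <= t -> exists B, forall n, (A n).[t] <= B.
Proof.
have [delta d0 dB] := lin_majorant_near0.
have scaled j : exists B, forall n, (A n).[zeta ^+ j * delta] <= B.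
  elim: j => [|j [B AB]]; first by exists (2 * delta); rewrite expr0 mul1r.
  exists (zeta * (zeta ^+ j * delta) + maj_const * (abs_poly N).[B]) => -[|n].
    rewrite hornerA big_ord0; apply: addr_ge0.
      by rewrite !mulr_ge0 ?exprn_ge0 // ltW.
    apply: mulr_ge0; first exact: ltW.
    apply: horner_nneg; first exact: nneg_abs_poly.
    by apply: le_trans (AB 0%N); rewrite hornerA big_ord0.
  have t0 : 0 <= zeta ^+ j * delta by rewrite mulr_ge0 ?exprn_ge0 ?ltW.
  rewrite exprS -mulrA; apply: le_trans (lin_majorant_step n t0) _.
  rewrite lerD2l ler_wpM2l ?(ltW K_gt0) //; apply: horner_nneg_mono => //.
    exact: nneg_abs_poly.
  by apply: horner_nneg => //; apply: nneg_abs_poly.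
move=> t0; have [j tj] : exists j, t <= zeta ^+ j * delta.
  have [j] := expr_unbounded (t / delta) zeta_gt1.
  by rewrite ler_pdivrMr //; exists j.
have [B AB] := scaled j; exists B => n; apply: le_trans (AB n).
by apply: horner_nneg_mono => //; apply: nneg_abs_poly.
Qed.

Lemma lin_coef_entire : entire lin_coef.
Proof.
apply: entire_bounded_norm => t t0; have [B AB] := lin_majorant_bounded t0.
by exists B => n; rewrite -hornerA.
Qed.

Definition lin_fun (x : R) : R := limn (pseries lin_coef x).

Lemma horner_lin_trunc n (x : R) : (lin_trunc n).[x] = pseries lin_coef x n.
Proof.
rewrite (@horner_coef_wide _ n _); last first.
  by apply/leq_sizeP => j lenj; rewrite coef_lin_trunc ltnNge lenj.
rewrite /pseries /series /= big_mkord.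
by apply: eq_bigr => i _; rewrite coef_lin_trunc ltn_ord.
Qed.

Lemma lin_trunc_cvg x : (lin_trunc n).[x] @[n --> \oo] --> lin_fun x.
Proof.
by under eq_fun do rewrite horner_lin_trunc; apply: lin_coef_entire.
Qed.

Lemma lin_funE x : lin_fun (zeta * x) = F.[lin_fun x].
Proof.
have cF : F.[(lin_trunc n).[x]] @[n --> \oo] --> F.[lin_fun x].
  have cont : {for lin_fun x, continuous (horner F)} by apply: continuous_horner.
  exact: (cvg_comp _ (horner F) (lin_trunc_cvg (x := x)) cont).
have cz := lin_trunc_cvg (x := zeta * x).
suff c0 : F.[(lin_trunc n).[x]] - (lin_trunc n).[zeta * x] @[n --> \oo] --> (0 : R).
  by apply/esym/subr0_eq; apply: cvg_unique (cvgB cF cz) c0.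
have [B AB] := lin_majorant_bounded (t := 2 * `|x|) ltac:(by rewrite mulr_ge0).
have B0 : 0 <= B by apply: le_trans (AB 0%N); rewrite hornerA big_ord0.
(* The two polynomials agree below degree n, whence a factor 2^-n. *)
have bound n : `|F.[(lin_trunc n).[x]] - (lin_trunc n).[zeta * x]| <=
    2^-1 ^+ n * (abs_poly F).[B].
  pose D := (F \Po lin_trunc n) - \poly_(i < n) (zeta ^+ i * lin_coef i).
  have -> : F.[(lin_trunc n).[x]] - (lin_trunc n).[zeta * x] = D.[x].
    rewrite [RHS]hornerD [X in _ = _ + X]hornerN [X in _ = X - _]horner_comp horner_poly.
    rewrite (@horner_coef_wide _ n (lin_trunc n) (zeta * x)).
      congr (_ - _); apply: eq_bigr => i _.
      by rewrite coef_lin_trunc ltn_ord exprMn mulrA [lin_coef i * _]mulrC.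
    by apply/leq_sizeP => j lenj; rewrite coef_lin_trunc ltnNge lenj.
  have majF := majorized_comp F (majorized_abs (lin_trunc n)).
  have D0 i : (i < n)%N -> D`_i = 0.
    by move=> lt_in; rewrite coefB coef_poly lt_in coef_compF // subrr.
  have majD : majorized D (abs_poly F \Po A n).
    move=> i; have [lt_in|le_ni] := ltnP i n.
      by rewrite D0 // normr0; apply: majorized_ge0 i majF.
    by rewrite coefB coef_poly ltnNge le_ni subr0; apply: majF.
  apply: le_trans (horner_high_order x majD D0) _; rewrite exprVn horner_comp.
  rewrite ler_pM2l ?invr_gt0 ?exprn_gt0 //; apply: horner_nneg_mono => //.
    exact: nneg_abs_poly.
  by apply: horner_nneg; [exact: nneg_abs_poly | rewrite mulr_ge0].
have half : `|2^-1 : R| < 1 by rewrite gtr0_norm ?invr_gt0 // invf_lt1 // ltr1n.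
have c0 : 2^-1 ^+ n * (abs_poly F).[B] @[n --> \oo] --> (0 : R).
  rewrite -(mul0r (abs_poly F).[B]); apply: cvgM; last exact: cvg_cst.
  exact: cvg_expr.
apply: norm_cvg0; apply: (squeeze_cvgr _ (cvg_cst (0 : R)) c0).
by apply: nearW => n; rewrite normr_ge0 /=.
Qed.

Lemma lin_fun0 : lin_fun 0 = 0.
Proof. by rewrite /lin_fun pseries_at0 lin_coef0. Qed.

End Linearization.

(** Koenigs and Poincare: a polynomial with a repelling fixed point at 0 is
linearized there by an entire function. Its derivatives are provided as a
sequence, so that smoothness needs no further work. *)
Lemma linearizing_function (R : realType) (F : {poly R}) :
  F.[0] = 0 -> 1 < F^`().[0] ->
  exists Phi : nat -> R -> R,
    [/\ forall i x, is_derive x (1 : R) (Phi i) (Phi i.+1 x),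
        Phi 0%N 0 = 0, Phi 1%N 0 = 1 &
        forall x, Phi 0%N (F^`().[0] * x) = F.[Phi 0%N x]].
Proof.
set zeta := F^`().[0] => F0 zeta1.
pose H := \poly_(i < size F) F`_(i.+2).
have FE : F = zeta *: 'X + 'X^2 * H.
  apply/polyP => i; rewrite coefD coefZ coefX coefXnM coef_poly.
  case: i => [|[|i]].
  - by rewrite mulr0 addr0 -horner_coef0.
  - by rewrite mulr1 addr0 /zeta horner_coef0 coef_deriv mulr1n.
  rewrite mulr0 add0r !subSS subn0; case: ltnP => // le_i.
  by rewrite nth_default // (leq_trans le_i) // -addn2 leq_addr.
exists (fun i x => limn (pseries (iter i (@pseries_diffs R) (lin_coef zeta H)) x)).
have ent i : entire (iter i (@pseries_diffs R) (lin_coef zeta H)).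
  by elim: i => [|i IH]; [exact: lin_coef_entire | exact: entire_diffs].
split=> [i x|||x].
- exact: entire_is_derive (ent i).
- exact: lin_fun0.
- by rewrite pseries_at0 /= /pseries_diffs mul1r.
- by rewrite [in RHS]FE; apply: lin_funE.
Qed.

(** * The conjugacy on the unit interval *)

Section FirstOrder.
Context {R : realType}.
Implicit Types (u : R -> R) (x l c z : R).

Lemma is_derive1_continuous u x c : is_derive x (1 : R) u c -> {for x, continuous u}.
Proof. by case=> du _; apply/differentiable_continuous/derivable1_diffP. Qed.

Lemma is_derive1_unique u x c c' :
  is_derive x (1 : R) u c -> is_derive x (1 : R) u c' -> c = c'.
Proof. by case=> _ <- [_ <-]. Qed.

Lemma cvg_div_expr l z : 1 < z -> l / z ^+ k @[k --> \oo] --> (0 : R).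
Proof.
move=> z1; have z0 : 0 < z by apply: lt_trans z1.
rewrite -(mulr0 l); apply: cvgM; first exact: cvg_cst.
under eq_fun do rewrite -exprVn.
by apply: cvg_expr; rewrite gtr0_norm ?invr_gt0 // invf_lt1.
Qed.

Lemma cvg_rescale u l c z : 1 < z -> u 0 = 0 -> is_derive 0 (1 : R) u c ->
  z ^+ k * u (l / z ^+ k) @[k --> \oo] --> c * l.
Proof.
move=> z1 u0 /is_derive1_caratheodory[g [ug gC <-]].
have z0 : 0 < z by apply: lt_trans z1.
have -> : (fun k => z ^+ k * u (l / z ^+ k)) = (fun k => g (l / z ^+ k) * l).
  apply/funext => k; have := ug (l / z ^+ k); rewrite u0 !subr0 => ->.
  by rewrite mulrCA; congr (_ * _); rewrite mulrC divfK // gt_eqF ?exprn_gt0.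
apply: cvgM; last exact: cvg_cst.
exact: (cvg_comp _ g (cvg_div_expr l z1) gC).
Qed.

End FirstOrder.

Section Conjugacy.
Context {R : realType} {F : {poly R}} {d c m : nat}.
Hypothesis Fs : s_shaped F d c m.
Variable p : R.
Hypotheses (p01 : 0 < p < 1) (Fp : F.[p] = p).
Let zeta : R := F^`().[p].
(* Psi 0 linearizes F at p, and Psi i is its i-th derivative. *)
Variable Psi : nat -> R -> R.
Hypotheses (dPsi : forall i x, is_derive x (1 : R) (Psi i) (Psi i.+1 x))
  (Psi_at0 : Psi 0%N 0 = p) (dPsi_at0 : Psi 1%N 0 = 1)
  (Psi_eq : forall x, Psi 0%N (zeta * x) = F.[Psi 0%N x]).
Implicit Types x q : R.

Let zeta_gt1 : 1 < zeta. Proof. exact: (s_shaped_multiplier_gt1 Fs p01 Fp). Qed.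
Let zeta_gt0 : 0 < zeta. Proof. exact: lt_trans zeta_gt1. Qed.

Lemma Psi_continuous i : continuous (Psi i).
Proof. by move=> x; apply: is_derive1_continuous (dPsi i x). Qed.

Lemma dPsi_eq x : zeta * Psi 1%N (zeta * x) = F^`().[Psi 0%N x] * Psi 1%N x.
Proof.
apply: (is_derive1_unique (u := fun x => Psi 0%N (zeta * x)) (x := x)).
  have dz : is_derive x (1 : R) (fun y => zeta * y) zeta.
    by have := is_derive1M (is_derive_cst zeta x 1) (is_derive_id x 1);
      move/is_derive_eq; apply; rewrite mul0r add0r mulr1.
  by rewrite mulrC; apply: (is_derive1_comp (dPsi 0%N (zeta * x)) dz).
rewrite (_ : (fun _ => _) = horner F \o Psi 0%N); last exact/funext.
exact: is_derive1_comp (is_derive_poly F _) (dPsi 0%N x).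
Qed.

(** Both properties hold near 0 and are transported from x to zeta x by the
functional equation. *)
Lemma Psi_itv_deriv x : (0 < Psi 0%N x < 1) /\ 0 < Psi 1%N x.
Proof.
have [n near0] : exists n, (0 < Psi 0%N (x / zeta ^+ n) < 1) /\ 0 < Psi 1%N (x / zeta ^+ n).
  have xz := cvg_div_expr x zeta_gt1.
  have c0 := cvg_comp _ (Psi 0%N) xz (@Psi_continuous 0%N 0).
  have c1 := cvg_comp _ (Psi 1%N) xz (@Psi_continuous 1%N 0).
  rewrite Psi_at0 in c0; rewrite dPsi_at0 in c1; have /andP[p0 p1] := p01.
  have : \forall n \near \oo,
      (0 < Psi 0%N (x / zeta ^+ n) < 1) /\ 0 < Psi 1%N (x / zeta ^+ n).
    near=> n; split; last by near: n; apply: (cvgr_gt (1 : R) c1).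
    apply/andP; split; near: n; first exact: (cvgr_gt p c0).
    exact: (cvgr_lt p c0).
  by case=> n _ /(_ n (leqnn n)); exists n.
rewrite -[x](divfK (x := zeta ^+ n)) ?gt_eqF ?exprn_gt0 // [_ * zeta ^+ n]mulrC.
move: (x / zeta ^+ n) near0 => {}x; elim: n => [|n IH] near0.
  by rewrite expr0 mul1r.
have [itv pos] := IH near0; rewrite exprS -mulrA; split.
  by rewrite Psi_eq; exact: (s_shaped_itv Fs itv).
rewrite -(pmulr_rgt0 _ zeta_gt0) dPsi_eq mulr_gt0 //.
exact: (s_shaped_deriv_gt0 Fs itv).
Unshelve. all: by end_near. Qed.

Lemma Psi_itv x : 0 < Psi 0%N x < 1.
Proof. by case: (Psi_itv_deriv x). Qed.

Lemma dPsi_gt0 x : 0 < Psi 1%N x.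
Proof. by case: (Psi_itv_deriv x). Qed.

Lemma Psi_lt x y : x < y -> Psi 0%N x < Psi 0%N y.
Proof.
move=> xy; apply: (derive_gt0_lt (df := Psi 1%N)) => // t _; exact: dPsi_gt0.
Qed.

Lemma Psi_le x y : x <= y -> Psi 0%N x <= Psi 0%N y.
Proof. by rewrite le_eqVlt => /orP[/eqP -> //|/Psi_lt/ltW]. Qed.

Lemma Psi_inj : injective (Psi 0%N).
Proof.
by move=> x y eq; case: (ltgtP x y) => // /Psi_lt; rewrite eq ltxx.
Qed.

Lemma Psi_iter k x : Psi 0%N (zeta ^+ k * x) = iter k (horner F) (Psi 0%N x).
Proof.
by elim: k => [|k IH]; rewrite ?expr0 ?mul1r // exprS -mulrA Psi_eq IH.
Qed.

Lemma orbit_limit_fixed x l :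
  Psi 0%N (zeta ^+ k * x) @[k --> \oo] --> l -> F.[l] = l.
Proof.
move=> cv; pose u k := Psi 0%N (zeta ^+ k * x).
have Fu : horner F \o u = [sequence u n.+1]_n.
  by apply/funext => k /=; rewrite /u exprS -mulrA Psi_eq.
have cFu : (horner F \o u) n @[n --> \oo] --> l by rewrite Fu cvg_shiftS.
exact: (cvg_unique _ (cvg_comp u (horner F) cv (@continuous_horner R F l)) cFu).
Qed.

(** The orbit of Psi 1 increases to a fixed point larger than p, that is, 1. *)
Lemma Psi_above q : q < 1 -> exists2 x, 0 < x & q < Psi 0%N x.
Proof.
move=> q1; pose u k := Psi 0%N (zeta ^+ k * 1).
have u_mono : nondecreasing_seq u.
  by move=> i j ij; apply: Psi_le; rewrite !mulr1 ler_weXn2l // ltW.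
have u_ub : has_ubound (range u).
  by exists 1 => _ [k _ <-]; have /andP[_ /ltW] := Psi_itv (zeta ^+ k * 1).
have cu := nondecreasing_is_cvgn u_mono u_ub.
have /= Fl := orbit_limit_fixed cu.
have l1 : limn u <= 1.
  by apply: limr_le => //; apply: nearW => k;
    have /andP[_ /ltW] := Psi_itv (zeta ^+ k * 1).
have lp : p < limn u.
  apply: lt_le_trans (nondecreasing_cvgn_le u_mono cu 0).
  by rewrite -Psi_at0; apply: Psi_lt; rewrite expr0 mulr1.
have l_eq1 : limn u = 1.
  apply/eqP; rewrite eq_le l1 leNgt; apply/negP => lt1.
  have /andP[p0 _] := p01.
  have l01 : 0 < limn u < 1 by rewrite (lt_trans p0 lp).
  by move: lp; rewrite (s_shaped_fixed_unique Fs p01 Fp l01 Fl) ltxx.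
have ql : q < limn u by rewrite l_eq1.
have [k _ /(_ k (leqnn k)) /= uk] := cvgr_gt _ cu _ ql.
by exists (zeta ^+ k * 1) => //; rewrite mulr1 exprn_gt0.
Qed.

(** The orbit of Psi (-1) decreases to a fixed point smaller than p, that is, 0. *)
Lemma Psi_below q : 0 < q -> exists2 x, 0 < x & Psi 0%N (- x) < q.
Proof.
move=> q0; pose u k := Psi 0%N (zeta ^+ k * -1).
have u_mono : nonincreasing_seq u.
  by move=> i j ij; apply: Psi_le; rewrite !mulrN1 lerN2 ler_weXn2l // ltW.
have u_lb : has_lbound (range u).
  by exists 0 => _ [k _ <-]; have /andP[/ltW] := Psi_itv (zeta ^+ k * -1).
have cu := nonincreasing_is_cvgn u_mono u_lb.
have /= Fl := orbit_limit_fixed cu.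
have l0 : 0 <= limn u.
  by apply: limr_ge => //; apply: nearW => k;
    have /andP[/ltW] := Psi_itv (zeta ^+ k * -1).
have lp : limn u < p.
  apply: le_lt_trans (nonincreasing_cvgn_ge u_mono cu 0) _.
  by rewrite -Psi_at0; apply: Psi_lt; rewrite expr0 mul1r oppr_lt0.
have l_eq0 : limn u = 0.
  apply/eqP; rewrite eq_le l0 andbT leNgt; apply/negP => gt0.
  have /andP[_ p1] := p01.
  have l01 : 0 < limn u < 1 by rewrite gt0 (lt_trans lp p1).
  by move: lp; rewrite (s_shaped_fixed_unique Fs p01 Fp l01 Fl) ltxx.
have ql : limn u < q by rewrite l_eq0.
have [k _ /(_ k (leqnn k)) /= uk] := cvgr_lt _ cu _ ql.
by exists (zeta ^+ k); rewrite ?exprn_gt0 // -mulrN1.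
Qed.

Lemma Psi_onto q : 0 < q < 1 -> exists x, Psi 0%N x = q.
Proof.
case/andP=> /Psi_below[x x0 xq] /Psi_above[y y0 qy].
have xy : - x < y by rewrite (lt_trans _ y0) // oppr_lt0.
have [|z _ zq] := IVT_lt xy (@Psi_continuous 0%N) (v := q); first by rewrite xq.
by exists z.
Qed.

(** The inverse of [Psi 0] on the unit interval; it takes the value 0 outside. *)
Definition conj_fun (q : R) : R := xget 0 [set x | Psi 0%N x = q].

Local Notation h := conj_fun.

Lemma conj_funK q : 0 < q < 1 -> Psi 0%N (h q) = q.
Proof. by move=> /Psi_onto[x xq]; apply: (xgetI (P := [set x | Psi 0%N x = q]) 0 xq). Qed.

Lemma PsiK : cancel (Psi 0%N) h.
Proof. by move=> x; apply: Psi_inj; rewrite conj_funK // Psi_itv. Qed.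

Lemma conj_fun_eq q : 0 < q < 1 -> h F.[q] = zeta * h q.
Proof. by move=> q01; apply: Psi_inj; rewrite conj_funK ?Psi_eq ?conj_funK //
  (s_shaped_itv Fs). Qed.

Lemma conj_fun_fixed : h p = 0.
Proof. by rewrite -Psi_at0 PsiK. Qed.

Lemma is_derive_conj_fun q : 0 < q < 1 ->
  is_derive q (1 : R) h (Psi 1%N (h q))^-1.
Proof.
move=> q01; rewrite -{1}(conj_funK q01).
apply: (is_derive_inverse (f := Psi 0%N)).
- by near=> x; apply: PsiK.
- by near=> x; apply: Psi_continuous.
- by rewrite gt_eqF // dPsi_gt0.
Unshelve. all: by end_near. Qed.

(** A family of functions that contains the identity and is closed under
differentiation and under division by the derivative of Psi: composed with
[conj_fun], it contains all derivatives of [conj_fun]. *)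
Inductive jet : (R -> R) -> Prop :=
| jet_id : jet id
| jet_cst a : jet (cst a)
| jet_Psi i : jet (Psi i)
| jet_inv : jet (fun x => (Psi 1%N x)^-1)
| jet_D g1 g2 : jet g1 -> jet g2 -> jet (fun x => g1 x + g2 x)
| jet_M g1 g2 : jet g1 -> jet g2 -> jet (fun x => g1 x * g2 x).

Lemma jet_deriv g : jet g ->
  exists2 g', jet g' & forall x, is_derive x (1 : R) g (g' x).
Proof.
elim=> {g}.
- by exists (cst 1); [exact: jet_cst | move=> x; apply: is_derive_id].
- by move=> a; exists (cst 0); [exact: jet_cst | move=> x; apply: is_derive_cst].
- by move=> i; exists (Psi i.+1); [exact: jet_Psi | exact: dPsi].
- exists (fun x => (cst (-1) x * Psi 2%N x) * ((Psi 1%N x)^-1 * (Psi 1%N x)^-1)).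
    by do !apply: jet_M; [exact: jet_cst | exact: jet_Psi | exact: jet_inv | exact: jet_inv].
  move=> x; have nz : Psi 1%N x != 0 by rewrite gt_eqF // dPsi_gt0.
  apply: is_derive_eq (is_derive1V nz (dPsi 1%N x)) _.
  by rewrite mulN1r expr2 invfM.
- move=> g1 g2 _ [g1' j1 d1] _ [g2' j2 d2].
  by exists (fun x => g1' x + g2' x); [exact: jet_D | move=> x; apply: is_derive1D].
- move=> g1 g2 J1 [g1' j1 d1] J2 [g2' j2 d2].
  exists (fun x => g1' x * g2 x + g1 x * g2' x); last by move=> x; apply: is_derive1M.
  by apply: jet_D; apply: jet_M.
Qed.

Lemma near_unit_itv q : 0 < q < 1 -> \forall x \near q, 0 < x < 1.
Proof.
move=> q01; have q_itv : q \in `]0, 1[ by rewrite in_itv.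
by apply: filterS (near_in_itvoo q_itv) => x; rewrite in_itv.
Qed.

Lemma derive1n_conj_fun i : exists2 g, jet g &
  forall q, 0 < q < 1 -> (h^`(i))%classic q = g (h q).
Proof.
elim: i => [|i [g jg hg]]; first by exists id; [exact: jet_id |].
have [g' jg' dg] := jet_deriv jg.
exists (fun x => g' x * (Psi 1%N x)^-1); first by apply: jet_M => //; apply: jet_inv.
move=> q q01; rewrite derive1nS derive1E.
have dgh := is_derive1_comp (dg (h q)) (is_derive_conj_fun q01).
suff [_ ->] : is_derive q (1 : R) (h^`(i))%classic (g' (h q) / Psi 1%N (h q)) by [].
apply: near_eq_is_derive dgh.
by near=> x; rewrite /= hg //; near: x; apply: near_unit_itv.
Unshelve. all: by end_near. Qed.

Lemma is_derive_derive1n_conj_fun i q : 0 < q < 1 ->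
  is_derive q (1 : R) (h^`(i))%classic ((h^`(i.+1))%classic q).
Proof.
have [g jg hg] := derive1n_conj_fun i.
have [g' jg' dg] := jet_deriv jg.
move=> q01; rewrite derive1nS derive1E; apply: DeriveDef => //.
have dgh := is_derive1_comp (dg (h q)) (is_derive_conj_fun q01).
suff [] : is_derive q (1 : R) (h^`(i))%classic (g' (h q) / Psi 1%N (h q)) by [].
apply: near_eq_is_derive dgh.
by near=> x; rewrite /= hg //; near: x; apply: near_unit_itv.
Unshelve. all: by end_near. Qed.

Lemma derive1n_Psi i : ((Psi 0%N)^`(i))%classic = Psi i.
Proof.
elim: i => // i IH; rewrite derive1nS IH; apply/funext => x.
by rewrite derive1E; case: (dPsi i x).
Qed.

Lemma conj_fun_linear_conjugation r :
  linear_conjugation r (horner F) zeta p h (Psi 0%N).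
Proof.
split; last 1 first.
- rewrite derive1E; have [_ ->] := is_derive_conj_fun p01.
  by rewrite conj_fun_fixed dPsi_at0 invr1.
- split.
  + by move=> q q01; split=> //; apply: conj_funK.
  + by move=> x _; split; [exact: Psi_itv | exact: PsiK].
  + split=> [i _ q q01|q q01]; first by have [] := is_derive_derive1n_conj_fun i q01.
    exact: is_derive1_continuous (is_derive_derive1n_conj_fun r q01).
  + split=> [i _ x _|x _]; rewrite derive1n_Psi; first by have [] := dPsi i x.
    exact: Psi_continuous.
- exact: conj_fun_eq.
Qed.

(** Along an orbit, g(Psi(l)) = zeta^k g(Psi(l / zeta^k)), which tends to l
because g o Psi vanishes at 0 with derivative 1. *)
Lemma linear_conjugation_unique g ginv :
  linear_conjugation 1 (horner F) zeta p g ginv ->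
  forall q, 0 < q < 1 -> g q = h q.
Proof.
case=> -[_ _ [/(_ 0%N isT p p01) dg _] _] geq g1 q q01.
have {}dg : is_derive p (1 : R) g 1 by apply: DeriveDef; rewrite // -derive1E.
have gp : g p = 0.
  have := geq p p01; rewrite Fp => /eqP.
  rewrite -[X in X == _]mul1r -subr_eq0 -mulrBl mulf_eq0 subr_eq0 => /orP[/eqP z1|/eqP //].
  by move: zeta_gt1; rewrite -z1 ltxx.
rewrite -{1}(conj_funK q01); move: (h q) => l.
have giter k x : g (Psi 0%N (zeta ^+ k * x)) = zeta ^+ k * g (Psi 0%N x).
  elim: k => [|k IH]; first by rewrite expr0 !mul1r.
  by rewrite exprS -!mulrA Psi_eq geq ?IH //; apply: Psi_itv.
have du : is_derive 0 (1 : R) (g \o Psi 0%N) 1.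
  have d0 := dPsi 0%N 0; rewrite dPsi_at0 in d0; rewrite -[X in is_derive _ _ _ X]mulr1.
  by apply: is_derive1_comp d0; rewrite Psi_at0.
have u0 : (g \o Psi 0%N) 0 = 0 by rewrite /= Psi_at0.
have := cvg_rescale (l := l) zeta_gt1 u0 du; rewrite mul1r /=.
under eq_fun => k do rewrite -giter mulrC divfK ?gt_eqF ?exprn_gt0 //.
by move=> cv; apply: (cvg_unique _ (cvg_cst (g (Psi 0%N l))) cv).
Qed.

(** In the coordinate given by [conj_fun] the iteration is multiplication by
zeta, and this coordinate has derivative 1 at the fixed point. *)
Lemma iter_rescaled_cvg l :
  iter k (horner F) (p + l / zeta ^+ k) @[k --> \oo] --> Psi 0%N l.
Proof.
pose u t := h (p + t).
have u0 : u 0 = 0 by rewrite /u addr0 conj_fun_fixed.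
have du : is_derive 0 (1 : R) u 1.
  have dh := is_derive_conj_fun p01; rewrite conj_fun_fixed dPsi_at0 invr1 in dh.
  have dp : is_derive 0 (1 : R) (fun t => p + t) 1.
    have := is_derive1D (is_derive_cst p 0 (1 : R)) (is_derive_id 0 (1 : R)).
    by rewrite add0r.
  rewrite -[X in is_derive _ _ _ X]mulr1; apply: is_derive1_comp dp.
  by rewrite addr0.
have cu := cvg_rescale (l := l) zeta_gt1 u0 du; rewrite mul1r in cu.
apply: cvg_trans (cvg_comp _ (Psi 0%N) cu (@Psi_continuous 0%N l)).
apply: near_eq_cvg; have cz := cvg_div_expr l zeta_gt1.
have cpz : p + l / zeta ^+ k @[k --> \oo] --> p.
  by rewrite -[X in _ --> X]addr0; apply: cvgD => //; apply: cvg_cst.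
have near01 : \forall k \near \oo, 0 < p + l / zeta ^+ k < 1.
  exact: (cpz _ (near_unit_itv p01)).
near=> k; rewrite /= Psi_iter conj_funK //; near: k; exact: near01.
Unshelve. all: by end_near. Qed.

End Conjugacy.

(** * Stretched exponential tails *)

Section PowerGrowth.
Context {R : realType}.
Implicit Types (a z K : R) (l v : R -> R).

Lemma powR_log_base a z : 1 < z -> 0 < a -> z `^ log_base z a = a.
Proof.
move=> z1 a0; have z0 : 0 < z by apply: lt_trans z1.
by rewrite /powR gt_eqF // /log_base divfK ?lnK ?posrE // gt_eqF // ln_gt0.
Qed.

(** Adding K / (a - 1) to [l], or subtracting it, absorbs the error
terms into two one-sided inequalities without error, which are iterated from the
fundamental interval [x0, z x0]. *)
Lemma power_growth a z K x1 l : 1 < a -> 1 < z -> 0 <= K ->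
  {homo l : x y / x <= y} ->
  (forall M, exists x, M < l x) ->
  (forall x, x1 <= x -> a * l x - K <= l (z * x) <= a * l x + K) ->
  exists2 c, 0 < c & \forall x \near +oo_R,
    c^-1 * x `^ log_base z a <= l x <= c * x `^ log_base z a.
Proof.
move=> a1 z1 K0 l_mono l_unb l_eq; set nu := log_base z a.
have a0 : 0 < a by apply: lt_trans a1.
have z0 : 0 < z by apply: lt_trans z1.
have nu0 : 0 <= nu by rewrite divr_ge0 // ln_ge0 // ltW.
pose K' := K / (a - 1).
have K'E : K = (a - 1) * K' by rewrite mulrC divfK // subr_eq0 gt_eqF.
have K'0 : 0 <= K' by rewrite divr_ge0 // subr_ge0 ltW.
have [y ly] := l_unb K'.
(* From x0 on, the approximate equations hold and l exceeds K'. *)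
pose x0 := Num.max y (Num.max x1 1).
have x0_ge1 : 1 <= x0 by rewrite !le_max lexx !orbT.
have x0_gt0 : 0 < x0 by apply: lt_le_trans x0_ge1.
have x0_x1 : x1 <= x0 by rewrite !le_max lexx !orbT.
have lx0 : K' < l x0 by apply: lt_le_trans ly _; apply: l_mono; rewrite le_max lexx.
have x0_zx0 : x0 <= z * x0 by rewrite ler_peMl ?ltW.
pose C1 := (l x0 - K') / (z * x0) `^ nu.
pose C2 := (l (z * x0) + K') / x0 `^ nu.
have pow0 x : 0 < x -> 0 < x `^ nu by apply: powR_gt0.
have C1_gt0 : 0 < C1 by rewrite divr_gt0 ?subr_gt0 // pow0 // mulr_gt0.
have lzx0 : 0 < l (z * x0).
  by apply: le_lt_trans K'0 _; apply: lt_le_trans lx0 _; apply: l_mono.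
have C2_gt0 : 0 < C2 by rewrite divr_gt0 ?pow0 // ltr_wpDr.
have base x : x0 <= x -> x <= z * x0 ->
    C1 * x `^ nu <= l x - K' /\ l x + K' <= C2 * x `^ nu.
  move=> x0x xzx0; have xg0 : 0 < x by apply: lt_le_trans x0x.
  split.
    apply: (@le_trans _ _ (l x0 - K')); last by rewrite lerD2r l_mono.
    rewrite /C1 mulrAC ler_pdivrMr ?pow0 ?mulr_gt0 // ler_wpM2l ?subr_ge0 ?(ltW lx0) //.
    by apply: (ge0_ler_powR nu0); rewrite ?nnegrE ?(ltW xg0) ?(mulr_ge0 (ltW z0) (ltW x0_gt0)).
  apply: (@le_trans _ _ (l (z * x0) + K')); first by rewrite lerD2r l_mono.
  rewrite /C2 mulrAC ler_pdivlMr ?pow0 // ler_wpM2l //.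
    by apply: addr_ge0 K'0; apply/ltW.
  by apply: (ge0_ler_powR nu0); rewrite ?nnegrE ?(ltW xg0) ?(ltW x0_gt0).
have bounds n x : x0 <= x -> x <= z ^+ n.+1 * x0 ->
    C1 * x `^ nu <= l x - K' /\ l x + K' <= C2 * x `^ nu.
  elim: n x => [|n IH] x x0x xle; first by apply: base; rewrite // -[z]expr1.
  have [/base|zx0_x] := leP x (z * x0); first exact.
  pose t := x / z; have xE : x = z * t by rewrite mulrC divfK ?gt_eqF.
  have x0t : x0 <= t by rewrite ler_pdivlMr // mulrC ltW.
  have tg0 : 0 < t by apply: lt_le_trans x0t.
  have tle : t <= z ^+ n.+1 * x0 by rewrite ler_pdivrMr // mulrC mulrA -exprS.
  have [lo hi] := IH t x0t tle.
  have /andP[lo' hi'] := l_eq t (le_trans x0_x1 x0t).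
  have -> : x `^ nu = a * t `^ nu.
    by rewrite xE powRM ?(ltW z0) ?(ltW tg0) // powR_log_base.
  rewrite xE ![_ * (a * _)]mulrCA; split.
    apply: le_trans (ler_wpM2l (ltW a0) lo) _; apply: le_trans (lerD lo' (lexx (- K'))).
    by rewrite K'E; lra.
  apply: le_trans (ler_wpM2l (ltW a0) hi); apply: le_trans (lerD hi' (lexx K')) _.
  by rewrite K'E; lra.
exists (Num.max C2 C1^-1); first by rewrite lt_max C2_gt0.
near=> x.
have x0x : x0 <= x by near: x; apply: nbhs_pinfty_ge; rewrite num_real.
have [n xn] := expr_unbounded (x / x0) z1.
have xle : x <= z ^+ n.+1 * x0.
  rewrite -ler_pdivrMr //; apply: le_trans xn _.
  by rewrite ler_weXn2l // ltW.
have xg0 : 0 < x by apply: lt_le_trans x0x.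
have [lo hi] := bounds n x x0x xle; apply/andP; split.
  apply: (@le_trans _ _ (C1 * x `^ nu)); last by apply: le_trans lo _; rewrite gerBl.
  rewrite ler_wpM2r ?powR_ge0 // invf_ple ?posrE ?lt_max ?C2_gt0 //.
  by rewrite le_max lexx orbT.
apply: (@le_trans _ _ (C2 * x `^ nu)); first by apply: le_trans hi; rewrite lerDl.
by rewrite ler_wpM2r ?powR_ge0 // le_max lexx.
Unshelve. all: by end_near. Qed.

(** [- ln v] satisfies the hypotheses of [power_growth], with a = n. *)
Lemma power_decay (n m : nat) z v : (1 < n)%N -> 1 < z ->
  (forall x, 0 < v x) -> {homo v : x y /~ x <= y} ->
  (forall q, 0 < q -> exists x, v x < q) ->
  (forall x, v x <= 2^-1 ->
    v x ^+ n * 2^-1 ^+ m <= v (z * x) <= 2 ^+ m * v x ^+ n) ->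
  exists2 c, 0 < c & \forall x \near +oo_R,
    expR (- (c * x `^ log_base z n%:R)) <= v x <=
      expR (- (c^-1 * x `^ log_base z n%:R)).
Proof.
move=> n1 z1 v0 v_mono v_inf v_eq; pose l x := - ln (v x).
have vE x : v x = expR (- l x) by rewrite /l opprK lnK ?posrE.
have [x1 vx1] := v_inf 2^-1 ltac:(by rewrite invr_gt0).
have [|||||x x1x|c c0 cl] := @power_growth n%:R z (m%:R * ln 2) x1 l.
- by rewrite ltr1n.
- by [].
- by rewrite mulr_ge0 // ln_ge0 // ler1n.
- by move=> x y xy; rewrite lerN2 ler_ln ?posrE // v_mono.
- move=> M; have [x vx] := v_inf (expR (- M)) (expR_gt0 _); exists x.
  by rewrite ltrNr -ltr_expR lnK ?posrE.
- have vx : v x <= 2^-1 by apply: le_trans (v_mono _ _ x1x) (ltW vx1).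
  have vn : 0 < v x ^+ n by rewrite exprn_gt0.
  have /andP[lo hi] := v_eq x vx.
  have two0 : (0 : R) < 2 by [].
  have lnlo : ln (v x ^+ n * 2^-1 ^+ m) = n%:R * ln (v x) - m%:R * ln 2.
    rewrite lnM ?posrE ?exprn_gt0 ?invr_gt0 // !lnXn ?invr_gt0 // lnV ?posrE //.
    by rewrite -[_ *+ n]mulr_natl -[(- ln 2) *+ m]mulr_natl mulrN.
  have lnhi : ln (2 ^+ m * v x ^+ n) = m%:R * ln 2 + n%:R * ln (v x).
    by rewrite lnM ?posrE ?exprn_gt0 // !lnXn // -[_ *+ n]mulr_natl -[ln 2 *+ m]mulr_natl.
  move: lo hi; rewrite -ler_ln ?posrE ?mulr_gt0 ?exprn_gt0 ?invr_gt0 // lnlo => lo.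
  rewrite -ler_ln ?posrE ?mulr_gt0 ?exprn_gt0 // lnhi => hi.
  by rewrite /l mulrN; apply/andP; split; lra.
exists c => //; apply: filterS cl => x /andP[lo hi].
by rewrite vE !ler_expR !lerN2 hi lo.
Qed.

End PowerGrowth.

Section Tails.
Context {R : realType} {F : {poly R}} {d c m : nat}.
Hypothesis Fs : s_shaped F d c m.
Variable p : R.
Hypotheses (p01 : 0 < p < 1) (Fp : F.[p] = p).
Let zeta : R := F^`().[p].

(** The linearization at 0 of F(x + p) - p, translated back by p. *)
Lemma poincare_function : exists Psi : nat -> R -> R,
  [/\ forall i x, is_derive x (1 : R) (Psi i) (Psi i.+1 x),
      Psi 0%N 0 = p, Psi 1%N 0 = 1 &
      forall x, Psi 0%N (zeta * x) = F.[Psi 0%N x]].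
Proof.
pose G := (F \Po ('X + p%:P)) - p%:P.
have GE x : G.[x] = F.[x + p] - p.
  by rewrite /G !(hornerD, hornerN, hornerC, horner_comp, hornerX).
have dG : G^`().[0] = zeta.
  rewrite /G derivB derivC subr0 deriv_comp derivD derivX derivC addr0 mulr1.
  by rewrite horner_comp hornerD hornerX hornerC add0r.
have [||Phi [dPhi Phi0 dPhi0 Phi_eq]] := @linearizing_function R G.
- by rewrite GE add0r Fp subrr.
- by rewrite dG; apply: (s_shaped_multiplier_gt1 Fs p01 Fp).
rewrite dG in Phi_eq.
exists (fun i x => if i is 0%N then p + Phi 0%N x else Phi i x); split=> //.
- case=> [|i] x; last exact: dPhi.
  by have := is_derive1D (is_derive_cst p x (1 : R)) (dPhi 0%N x); rewrite add0r.
- by rewrite Phi0 addr0.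
- by move=> x; rewrite Phi_eq GE addrC subrK addrC.
Qed.

Variable Psi : nat -> R -> R.
Hypotheses (dPsi : forall i x, is_derive x (1 : R) (Psi i) (Psi i.+1 x))
  (Psi_at0 : Psi 0%N 0 = p) (dPsi_at0 : Psi 1%N 0 = 1)
  (Psi_eq : forall x, Psi 0%N (zeta * x) = F.[Psi 0%N x]).

Let zeta_gt1 : 1 < zeta. Proof. exact: (s_shaped_multiplier_gt1 Fs p01 Fp). Qed.
Let itv x : 0 < Psi 0%N x < 1.
Proof. exact: (Psi_itv Fs p01 Fp dPsi Psi_at0 dPsi_at0 Psi_eq). Qed.
Let mono x y : x <= y -> Psi 0%N x <= Psi 0%N y.
Proof. exact: (Psi_le Fs p01 Fp dPsi Psi_at0 dPsi_at0 Psi_eq). Qed.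

(** Near 0 the polynomial is comparable to the power [d], so minus the
logarithm of Psi is multiplied by [d], up to a bounded error, when the
argument is multiplied by zeta. *)
Lemma Psi_left_tail : exists2 c1, 0 < c1 & \forall x \near +oo_R,
  expR (- (c1 * x `^ log_base zeta d%:R)) <= Psi 0%N (- x) <=
    expR (- (c1^-1 * x `^ log_base zeta d%:R)).
Proof.
apply: (@power_decay _ d m zeta (fun x => Psi 0%N (- x))) => //.
- exact: s_shaped_d Fs.
- by move=> x; case/andP: (itv (- x)).
- by move=> x y xy; apply: mono; rewrite lerN2.
- move=> q /(Psi_below Fs p01 Fp dPsi Psi_at0 dPsi_at0 Psi_eq)[x _ xq].
  by exists x.
move=> x half; rewrite -mulrN Psi_eq; have /andP[y0 y1] := itv (- x).
set y := Psi 0%N (- x) in half y0 y1 *.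
have y01 : 0 <= y <= 1 by rewrite !ltW.
have /andP[lo ->] := s_shaped_at0 Fs y01; rewrite andbT; apply: le_trans lo.
rewrite ler_wpM2l ?exprn_ge0 ?(ltW y0) // lerXn2r ?qualifE /= ?invr_ge0 ?subr_ge0 ?(ltW y1) //.
lra.
Qed.

Lemma Psi_right_tail : exists2 c2, 0 < c2 & \forall x \near +oo_R,
  expR (- (c2 * x `^ log_base zeta c%:R)) <= 1 - Psi 0%N x <=
    expR (- (c2^-1 * x `^ log_base zeta c%:R)).
Proof.
apply: (@power_decay _ c m zeta (fun x => 1 - Psi 0%N x)) => //.
- exact: s_shaped_c Fs.
- by move=> x; case/andP: (itv x); rewrite subr_gt0.
- by move=> x y xy; rewrite lerD2l lerN2; apply: mono.
- move=> q q0; have q1 : 1 - q < 1 by rewrite gtrBl.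
  have [x _ xq] := Psi_above Fs p01 Fp dPsi Psi_at0 dPsi_at0 Psi_eq q1.
  by exists x; rewrite ltrBlDl -ltrBlDr.
move=> x half; rewrite Psi_eq; have /andP[y0 y1] := itv x.
set y := Psi 0%N x in half y0 y1 *.
have y01 : 0 <= y <= 1 by rewrite !ltW.
have /andP[lo ->] := s_shaped_at1 Fs y01; rewrite andbT; apply: le_trans lo.
rewrite ler_wpM2l ?exprn_ge0 ?subr_ge0 ?(ltW y1) //
  lerXn2r ?qualifE /= ?invr_ge0 ?(ltW y0) //.
lra.
Qed.

End Tails.

Theorem theorem9p1 (R : realType) (G1 : ograph)
  (G1_simple : simple_graph G1)
  (G1_connected : connected_graph G1)
  (G1_dist : (1 < dist (va G1) (vb G1))%N)
  (G1_paths : two_edge_disjoint_paths (va G1) (vb G1)) :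
  let f : R -> R := @crossing_prob G1 R in
  let fk (k : nat) : R -> R := @crossing_prob (hgraph G1 k) R in
  exists pstar : R,
    (unit_itv pstar /\ f pstar = pstar) /\
    (forall q : R, unit_itv q -> f q = q -> q = pstar) /\
    let zeta : R := (f^`())%classic pstar in
    let nu : R := log_base zeta (dist (va G1) (vb G1))%:R in
    let mu : R := log_base zeta (Cut G1)%:R in
    1 < zeta /\
    exists h hinv : R -> R,
      (* h is smooth, and unique already among C^1 diffeomorphisms *)
      (forall r : nat, linear_conjugation r f zeta pstar h hinv) /\
      (forall g ginv : R -> R, linear_conjugation 1 f zeta pstar g ginv ->
         forall x : R, unit_itv x -> g x = h x) /\
      (forall lambda : R,
         fk k (pstar + lambda / zeta ^+ k) @[k --> \oo] --> hinv lambda) /\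
      (exists c1 : R, 0 < c1 /\
         \forall lambda \near -oo_R,
           expR (- (c1 * `|lambda| `^ nu)) <= hinv lambda
             <= expR (- (c1^-1 * `|lambda| `^ nu))) /\
      (exists c2 : R, 0 < c2 /\
         \forall lambda \near +oo_R,
           1 - expR (- (c2 * lambda `^ mu)) <= hinv lambda
             <= 1 - expR (- (c2^-1 * lambda `^ mu))).
Proof.
pose F := crossing_poly R G1.
have Fs := crossing_poly_s_shaped R G1_connected G1_dist G1_paths; rewrite -/F in Fs.
have neq : va G1 != vb G1.
  by apply: contraL G1_dist => /eqP ->; rewrite dist_refl.
have fE : @crossing_prob G1 R = horner F.
  by apply/funext => q; rewrite horner_crossing_poly.
move=> f fk; have [p p01 Fp] := s_shaped_fixed_ex Fs.
exists p; split; first by rewrite /f fE.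
split=> [q q01|]; first by rewrite /f fE; apply: (s_shaped_fixed_unique Fs p01 Fp q01).
have zE : (f^`())%classic p = F^`().[p] by rewrite /f fE -derivE.
rewrite zE => zeta nu mu.
split; first exact: (s_shaped_multiplier_gt1 Fs p01 Fp).
have [Psi [dPsi Psi0 dPsi0 Psi_eq]] := poincare_function Fs p01 Fp.
exists (conj_fun Psi), (Psi 0%N); split=> [r|].
  rewrite /f fE.
  exact: (conj_fun_linear_conjugation Fs p01 Fp dPsi Psi0 dPsi0 Psi_eq r).
split=> [g ginv|].
  rewrite /f fE => gconj q q01.
  exact: (linear_conjugation_unique Fs p01 Fp dPsi Psi0 dPsi0 Psi_eq gconj q01).
split=> [lambda|].
  have -> : (fun k => fk k (p + lambda / zeta ^+ k)) =
      (fun k => iter k (horner F) (p + lambda / zeta ^+ k)).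
    by apply/funext => k; rewrite /fk crossing_prob_hgraph // fE.
  exact: (iter_rescaled_cvg Fs p01 Fp dPsi Psi0 dPsi0 Psi_eq).
have [c1 c1_gt0 [A1 [A1r left_tail]]] := Psi_left_tail Fs p01 Fp dPsi Psi0 dPsi0 Psi_eq.
have [c2 c2_gt0 right_tail] := Psi_right_tail Fs p01 Fp dPsi Psi0 dPsi0 Psi_eq.
split.
  exists c1; split=> //; exists (Num.min 0 (- A1)); split.
    by rewrite num_real.
  move=> x; rewrite lt_min => /andP[x0 xA1].
  by have := left_tail (- x); rewrite opprK (ltr0_norm x0) ltrNr; apply.
exists c2^-1; split; first by rewrite invr_gt0.
apply: filterS right_tail => x /andP[lo hi].
by rewrite -/zeta -/mu in lo hi; rewrite invrK; apply/andP; split; lra.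
Qed.
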